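(* For any $\beta\in(2,\infty)$, almost surely, $\tau_n\le T_n\le \mathrm{e}^{\beta^n}$ for all but finitely many $n$.
   Context: Fix $\lambda=\mu\in(0,\infty)$. Write $\mathbb{Z}_+=\{0,1,2,\ldots\}$, $\mathbb{R}_+=[0,\infty)$. $P(\kappa)$ denotes a Poisson random variable with mean $\kappa\in\mathbb{R}_+$; for a random variable $W\ge 0$, $P(W)$ denotes a random variable that, conditional on $W$, is Poisson with mean $W$. For $k\in\mathbb{Z}_+$, $\zeta(k)$ denotes a random variable distributed as the time to empty (first time with $0$ customers) of an M/M/1 queue with arrival rate and service rate both $\lambda$ started from $k$ customers; for a $\mathbb{Z}_+$-valued random variable $W$, $\zeta(W)$ is, conditional on $W$, distributed as the time to empty from $W$ customers. Let $\xi_0,\xi_1,\ldots$ be i.i.d. with $\mathbb{P}(\xi_n=\pm1)=1/2$ (tie-breakers, independent of the other random ingredients). The greedy server on $\mathbb{Z}$, observed at the successive times at which it empties a queue, is the Markov process $\Psi_n=(Q_n,X_n,T_n)$, $n\in\mathbb{Z}_+$, with $Q_n=(Q_n(x))_{x\in\mathbb{Z}}\in(\mathbb{Z}_+\cup\{*\})^{\mathbb{Z}}$, $X_n\in\mathbb{Z}$, $T_n\in\mathbb{R}_+$ (the symbol $*$ means the queue has not yet been inspected). Initially $Q_0(x)=0$ for $x\in\{-1,0,1\}$, $Q_0(x)=*$ for $|x|\ge2$, $X_0=0$, $T_0=0$. Given $(Q_n,X_n,T_n)$: - $\eta_{n+1}=+1$ if $Q_n(X_n+1)>Q_n(X_n-1)$,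 $\eta_{n+1}=-1$ if $Q_n(X_n-1)>Q_n(X_n+1)$, and $\eta_{n+1}=\xi_n$ if $Q_n(X_n+1)=Q_n(X_n-1)$; $X_{n+1}=X_n+\eta_{n+1}$. - $\tau_{n+1}$ is distributed as $1+\zeta(Q_n(X_{n+1})+P(\lambda))$; $T_{n+1}=T_n+\tau_{n+1}$. - For each $k\in\mathbb{Z}\setminus\{X_{n+1}\}$ with $Q_n(k)\ne *$, $Q_{n+1}(k)$ is distributed as $Q_n(k)+P(\lambda\tau_{n+1})$, independently for each $k$. - If $Q_n(X_{n+1}+1)=*$ then $Q_{n+1}(X_{n+1}+1)$ is distributed as $P(\lambda T_{n+1})$, and if $Q_n(X_{n+1}-1)=*$ then $Q_{n+1}(X_{n+1}-1)$ is distributed as $P(\lambda T_{n+1})$, independently; all other entries equal to $*$ remain $*$. - $Q_{n+1}(X_{n+1})=0$. *)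

(* Defs.v *)
From HB Require Import structures.
From mathcomp Require Import all_boot all_order all_algebra.
From mathcomp Require Import all_classical all_reals all_analysis.
From mathcomp Require Import measurable_realfun.

Set Implicit Arguments.
Unset Strict Implicit.
Unset Printing Implicit Defensive.

Import Order.TTheory GRing.Theory Num.Theory.
Import numFieldNormedType.Exports.

Local Open Scope classical_set_scope.
Local Open Scope ring_scope.

(* The library's [poisson_pmf] is constantly 1 at rate 0, where P(0) has to be
   the point mass at 0. *)
Definition poisson_mass (R : realType) (kappa : R) (j : nat) : R :=
  if 0 < kappa then poisson_pmf kappa j else (j == 0%N)%:R.

Definition mutually_independent (R : realType) d (Omega : measurableType d)
    (P : probability Omega R) (I : eqType) (Y : I -> Omega -> R) : Prop :=
  forall (s : seq I) (B : I -> set R), uniq s ->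
    (forall i, measurable (B i)) ->
    P [set w | forall i, i \in s -> B i (Y i w)] =
    (\prod_(i <- s) P (Y i @^-1` B i))%E.

(* Customers of a first-come-first-served single-server queue are numbered from
   0, the first k of them being present at time 0.  [a i] are the interarrival
   times and [s m] the service times. *)
Section single_server_queue.
Context (R : realType) (k : nat) (a s : nat -> R).

(* The truncated subtraction makes this 0 for m < k. *)
Definition arrival (m : nat) : R := \sum_(i < m.+1 - k) a i.

Fixpoint departure (m : nat) : R :=
  match m with
  | 0%N => arrival 0 + s 0
  | m'.+1 => Num.max (arrival m'.+1) (departure m') + s m'.+1
  end.

Definition customers (t : R) : set nat :=
  [set m | arrival m <= t < departure m].

Definition time_to_empty : \bar R :=
  ereal_inf [set t%:E | t in [set t : R | 0 <= t /\ customers t = set0]].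

End single_server_queue.

(* [nu] is the law of zeta(k) for the M/M/1 queue with arrival rate [lam] and
   service rate [mu]; [Y (inl i)] are the interarrival times, [Y (inr m)] the
   service times.  The random variable [Z] is a real-valued version of the time
   to empty, which lives in [\bar R]. *)
Definition mm1_time_to_empty_law (R : realType) (lam mu : R) (k : nat)
    (nu : probability (measurableTypeR R) R) : Prop :=
  exists (d : measure_display) (Omega : measurableType d)
      (P : probability Omega R)
      (Y : nat + nat -> {RV P >-> measurableTypeR R})
      (Z : {RV P >-> measurableTypeR R}),
  [/\ mutually_independent P (fun i => Y i : Omega -> R),
      forall i B, measurable B -> distribution P (Y (inl i)) B =
                                  exponential_prob lam B,
      forall m B, measurable B -> distribution P (Y (inr m)) B =
                                  exponential_prob mu B,
      {ae P, forall w, (Z w)%:E =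
         time_to_empty k (fun i => Y (inl i) w) (fun m => Y (inr m) w)} &
      forall B, measurable B -> nu B = distribution P Z B].

(* [p] is a version of the conditional probability of [E] given the
   sigma-algebra [G]. *)
Definition cond_prob (R : realType) d (Omega : measurableType d)
    (P : probability Omega R) (G : set (set Omega)) (E : set Omega)
    (p : Omega -> \bar R) : Prop :=
  (forall B : set (\bar R), measurable B -> G (p @^-1` B)) /\
  (forall A, G A -> P (A `&` E) = \int[P]_(w in A) p w)%E.

Section greedy_server.
Context (R : realType) (lam : R).
Context (zeta : nat -> probability (measurableTypeR R) R).

(* [q k = None] stands for q(k) = *.  Both neighbours of the server have always
   been inspected, so the default value of [odflt] is never used. *)
Definition direction (q : int -> option nat) (x tie : int) : int :=
  let r := odflt 0%N (q (x + 1)) in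
  let l := odflt 0%N (q (x - 1)) in
  if (l < r)%N then 1 else if (r < l)%N then -1 else tie.

(* The law of 1 + zeta(m + P(lambda)). *)
Definition step_time_law (m : nat) (B : set R) : \bar R :=
  (\sum_(0 <= j <oo)
     (poisson_mass lam j)%:E * zeta (m + j)%N [set u : R | B (1 + u)%R])%E.

(* The probability that the entry at k is [c] after a step from the queue
   lengths [q], where the server moved to [x], the step took time [tau] and
   ended at time [t]. *)
Definition entry_law (q : int -> option nat) (x : int) (tau t : R)
    (k : int) (c : option nat) : R :=
  if k == x then (c == Some 0%N)%:R
  else match q k with
       | Some m => if c is Some j then
                     if (m <= j)%N then poisson_mass (lam * tau) (j - m) else 0
                   else 0
       | None => if (k == x + 1) || (k == x - 1) then
                   if c is Some j then poisson_mass (lam * t) j else 0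
                 else (c == None)%:R
       end.

Context d (Omega : measurableType d) (P : probability Omega R).
Context (xi : nat -> Omega -> int) (Q : nat -> int -> Omega -> option nat)
  (X : nat -> Omega -> int) (tau T : nat -> Omega -> R).

Definition level_sets (V : Type) (Y : Omega -> V) : set (set Omega) :=
  [set Y @^-1` [set v] | v in setT].

Definition borel_preimages (Y : Omega -> R) : set (set Omega) :=
  [set Y @^-1` B | B in measurable].

(* sigma(Psi_0, ..., Psi_n, xi_0, ..., xi_(n-1)), by generators. *)
Definition history_gen (n : nat) : set (set Omega) :=
  (\bigcup_(m in `I_n.+1)
     ((\bigcup_k level_sets (Q m k)) `|` level_sets (X m) `|`
      borel_preimages (T m))) `|`
  \bigcup_(m in `I_n) level_sets (xi m).

Definition history (n : nat) : set (set Omega) := <<s history_gen n >>.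

Definition history_tie (n : nat) : set (set Omega) :=
  <<s history_gen n `|` level_sets (xi n) >>.

Definition history_tie_tau (n : nat) : set (set Omega) :=
  <<s history_gen n `|` level_sets (xi n) `|` borel_preimages (tau n.+1) >>.

(* The randomness of each step is revealed in the order xi_n, tau_(n+1),
   Q_(n+1), each having its prescribed conditional law given everything revealed
   before; in particular the xi_n are i.i.d. uniform signs independent of the
   other sources of randomness.  [tau 0] plays no role. *)
Record greedy_server : Prop := GreedyServer {
  gs_meas_xi : forall n v, measurable (xi n @^-1` [set v]);
  gs_meas_Q : forall n k c, measurable (Q n k @^-1` [set c]);
  gs_meas_X : forall n x, measurable (X n @^-1` [set x]);
  gs_meas_tau : forall n, measurable_fun setT (tau n);
  gs_meas_T : forall n, measurable_fun setT (T n);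
  gs_T_ge0 : forall n w, 0 <= T n w;
  gs_Q0 : forall k w, Q 0 k w = if (`|k| <= 1)%R then Some 0%N else None;
  gs_X0 : forall w, X 0 w = 0;
  gs_T0 : forall w, T 0 w = 0;
  gs_XS : forall n w,
    X n.+1 w = X n w + direction (fun k => Q n k w) (X n w) (xi n w);
  gs_TS : forall n w, T n.+1 w = T n w + tau n.+1 w;
  gs_xi : forall n v, v = 1 \/ v = -1 ->
    cond_prob P (history n) (xi n @^-1` [set v]) (fun=> (2^-1 : R)%:E);
  gs_tau : forall n (B : set R), measurable B ->
    cond_prob P (history_tie n) (tau n.+1 @^-1` B)
      (fun w => step_time_law (odflt 0%N (Q n (X n.+1 w) w)) B);
  gs_QS : forall n (K : seq int) (c : int -> option nat), uniq K ->
    cond_prob P (history_tie_tau n)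
      [set w | forall k, k \in K -> Q n.+1 k w = c k]
      (fun w => (\prod_(k <- K) entry_law (fun k' => Q n k' w) (X n.+1 w)
                                  (tau n.+1 w) (T n.+1 w) k (c k))%:E)
}.

End greedy_server.

(* Main.v *)
Require Import Defs.
From HB Require Import structures.
From mathcomp Require Import all_boot all_order all_algebra.
From mathcomp Require Import all_classical all_reals all_analysis.
From mathcomp Require Import measurable_realfun.
From mathcomp Require Import ring lra zify.

(** The time to empty from k customers has tail at most a constant times
    k / sqrt t ([mm1_time_to_empty_tail]): to empty, a symmetric random walk has
    to gain k, which takes time of order k^2 and has a heavy tail of exponent
    1/2.  As customers arrive at rate lam, on the event T_n <= b every queue
    inspected so far has mean length at most of order n b ([queue_mean_le]), and
    the queue which the server picks is one of 2 n + 3.  Hence, up to a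
    polynomial factor in n, the event that T_n <= b and T_(n+1) > b^gam has
    probability at most b / sqrt (b^gam) = b^(1 - gam/2), which is small as soon
    as gam > 2 ([step_time_tail]).

    Given 2 < gam < beta and l > 0, let b_n = exp(l gam^n), so that
    b_(n+1) = b_n^gam.  As T_0 = 0 < b_0, if some T_n exceeds b_n then a first
    one does, and summing the bound above over n shows that the probability of
    this is O(l^-3) ([escape_probability]).  Letting l tend to infinity, almost
    surely there is an l with T_n <= exp(l gam^n) for all n, and l gam^n is
    eventually smaller than beta^n.  Comparing with a sequence of thresholds
    that starts at time 0, with l arbitrary, avoids any question on how T_n
    gets below exp(beta^n) in the first place.

    For the tail of the time to empty, write lam for the common rate and follow
    the workload: the time still needed to serve the customers present.  Until
    the queue empties, an interarrival time a takes the elapsed time e and the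
    workload W to e + a and W - a + s, where s is the service time of the new
    customer; the queue empties, at time e + W, when W < a.  With
    sigma = eta^2 / (lam + eta) the quantity exp(- sigma e - eta W) has constant
    mean along this chain ([integral_drainS]), because of an identity for the
    exponential law ([workload_step_identity]).  At the start e = 0 and W is a
    sum of k service times, and the mean is (lam / (lam + eta))^k; in the end
    W = 0 and e is the time to empty, zeta.  Therefore
    E exp(- sigma zeta) >= (lam / (lam + eta))^k >= 1 - k eta / lam, and
    Markov's inequality for 1 - exp(- sigma zeta), with sigma of order 1 / t,
    gives the tail above. *)

Set Implicit Arguments.
Unset Strict Implicit.

Import Order.TTheory GRing.Theory Num.Theory.
Import numFieldNormedType.Exports.

Local Open Scope classical_set_scope.
Local Open Scope ring_scope.

(** * Fubini's theorem for mutually independent random variables *)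

Section independence.
Context (R : realType) d (Omega : measurableType d) (P : probability Omega R).
Context (I : eqType) (Y : I -> Omega -> R).
Hypothesis mY : forall i, measurable_fun setT (Y i).
Hypothesis indY : mutually_independent P Y.

(** For a fixed finite list of indices these sets are closed under intersection,
    which is what the uniqueness of measures needs. *)
Definition cylinders (s : seq I) : set (set Omega) :=
  [set [set w | forall i, i \in s -> B i (Y i w)] |
    B in [set B : I -> set R | forall i, measurable (B i)]].

(** The sample space, seen through the variables with index in [s] only: a
    function of these variables is one that is measurable on this space. *)
Definition observed (s : seq I) := g_sigma_algebraType (cylinders s).

Lemma measurable_cylinders s : cylinders s `<=` measurable.
Proof.
move=> _ [B mB <-].
elim: s => [|j s IHs].
  by rewrite [X in measurable X](_ : _ = setT)//; apply/seteqP; split.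
rewrite [X in measurable X](_ : _ = Y j @^-1` B j `&`
   [set w | forall i, i \in s -> B i (Y i w)]); last first.
  apply/seteqP; split => [w /= h|w /= [h1 h2] i].
    by split=> [|i si]; apply: h; rewrite inE ?eqxx// si orbT.
  by rewrite inE => /predU1P[->|/h2].
by apply: measurableI => //; rewrite -[X in measurable X]setTI; exact: mY.
Qed.

Lemma measurable_observed s : <<s cylinders s>> `<=` measurable.
Proof.
apply: smallest_sub; [exact: sigma_algebra_measurable|].
exact: measurable_cylinders.
Qed.

Lemma observed_measurable_fun s i : i \in s ->
  measurable_fun setT (Y i : observed s -> R).
Proof.
move=> si _ B mB; rewrite setTI; apply: sub_sigma_algebra.
exists (fun j => if j == i then B else setT).
  by move=> j /=; case: ifP.
apply/seteqP; split => [w /(_ i si)|w /= h j _]; first by rewrite eqxx.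
by case: eqP => // ->.
Qed.

Lemma measurable_fun_observed s d' (T : measurableType d') (f : Omega -> T) :
  measurable_fun setT (f : observed s -> T) -> measurable_fun setT f.
Proof.
by move=> mf _ A mA; apply: (@measurable_observed s); exact: (mf measurableT).
Qed.

Lemma setI_closed_cylinders s : setI_closed (cylinders s).
Proof.
move=> _ _ [B mB <-] [C mC <-]; exists (fun i => B i `&` C i).
  by move=> i; apply: measurableI.
apply/seteqP; split => [w h|w [h1 h2] i si].
  by split=> i /h[].
by split; [apply: h1|apply: h2].
Qed.

(** On cylinders the product rule is the one for the longer list [j :: s]; both
    sides are finite measures in [A], hence they agree on the generated
    sigma-algebra. *)
Lemma observed_indep s j A B : uniq (j :: s) -> <<s cylinders s>> A ->
  measurable B -> P (A `&` Y j @^-1` B) = (P A * P (Y j @^-1` B))%E.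
Proof.
move=> /= /andP[js us] sA mB.
have mYB : measurable (Y j @^-1` B).
  by rewrite -[X in measurable X]setTI; exact: mY.
have fP : P (Y j @^-1` B) \is a fin_num by exact: fin_num_measure.
have p0 : 0 <= fine (P (Y j @^-1` B)) by exact: fine_ge0.
have := @g_sigma_algebra_measure_unique _ R Omega (cylinders s)
  (measurable_cylinders (s := s)) (fun=> setT) _ _ (mrestr P mYB)
  (mscale (NngNum p0) P) (setI_closed_cylinders (s := s)) _ _ A sA.
rewrite /= /mrestr /mscale /= fineK// muleC => -> //.
- move=> _; exists (fun=> setT) => //; apply/seteqP; split => //.
- by rewrite bigcup_const.
- move=> _ [C mC <-].
  pose D i := if i == j then B else C i.
  have mD i : measurable (D i) by rewrite /D; case: ifP.
  rewrite [X in P X = _](_ : _ =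
    [set w | forall i, i \in j :: s -> D i (Y i w)]); last first.
    apply/seteqP; split => [w [h1 h2] i|w h].
      by rewrite inE /D; case: eqP => [->//|_ /= /h1].
    split; last by have := h j; rewrite /= /D eqxx; apply; rewrite mem_head.
    move=> i si; have := h i; rewrite inE si orbT /D; case: eqP => [ij|_].
      by rewrite -ij si in js.
    exact.
  rewrite indY ?big_cons//=; last by rewrite js.
  rewrite /D eqxx; congr (_ * _)%E.
  rewrite indY//; apply: eq_big_seq => i si.
  by case: eqP => // ij; rewrite -ij si in js.
- by move=> _; rewrite /= setTI ltey_eq fP.
Qed.

(** The joint law of the observed variables and of a further one is a product
    measure, so that the further one can be integrated out first. *)
Lemma integral_observed s j (nu : probability (measurableTypeR R) R)
    (h : observed s * measurableTypeR R -> \bar R) : uniq (j :: s) ->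
  (forall B, measurable B -> P (Y j @^-1` B) = nu B) ->
  measurable_fun setT h -> (forall z, 0 <= h z)%E ->
  (\int[P]_w h (w, Y j w) = \int[P]_w \int[nu]_v h (w, v))%E.
Proof.
move=> us nuE mh h0.
have mid : measurable_fun setT (id : Omega -> observed s).
  move=> _ A sA; rewrite setTI. exact: (measurable_observed sA).
pose phi (w : Omega) : observed s * measurableTypeR R := (w, Y j w).
have mphi : measurable_fun setT phi.
  by apply: measurable_fun_pair => //; exact: mY.
pose idT : {mfun Omega >-> observed s} :=
  HB.pack (id : Omega -> observed s) (isMeasurableFun.Build _ _ _ _ _ mid).
pose phiT : {mfun Omega >-> (observed s * measurableTypeR R)%type} :=
  HB.pack phi (isMeasurableFun.Build _ _ _ _ _ mphi).
rewrite -[LHS]/(\int[P]_w (h \o phiT) w)%E -ge0_integral_distribution//.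
transitivity (\int[(distribution P idT \x nu)%E]_z h z)%E.
  apply: eq_measure_integral => A mA _; apply/esym.
  apply: product_measure_unique => // B C mB mC.
  transitivity (P B * P (Y j @^-1` C))%E.
    exact: (observed_indep us mB mC).
  by congr (_ * _)%E; exact: nuE.
rewrite fubini_tonelli1// ge0_integral_distribution//.
  exact: measurable_fun_fubini_tonelli_F.
by move=> w; apply: integral_ge0.
Qed.
End independence.

(** * Integrals against the exponential law *)

Section exponential_law.
Context (R : realType) (rate : R).
Hypothesis rate_gt0 : 0 < rate.
Local Notation mu := (@lebesgue_measure R).

Lemma integral_exponential_law (nu : probability (measurableTypeR R) R)
    (f : R -> \bar R) :
  (forall B, measurable B -> nu B = exponential_prob rate B) ->
  measurable_fun setT f -> (forall x, 0 <= f x)%E ->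
  (\int[nu]_x f x = \int[mu]_x (f x * (exponential_pdf rate x)%:E))%E.
Proof.
move=> nuE mf f0.
have mpdf : measurable_fun setT (fun x => (exponential_pdf rate x)%:E).
  by apply/measurable_EFinP; exact: measurable_exponential_pdf.
have numu : nu `<< mu.
  apply/null_content_dominatesP => A mA muA0; rewrite nuE//.
  rewrite /exponential_prob null_set_integral//.
  exact: measurable_funTS.
rewrite -(Radon_Nikodym_SigmaFinite.change_of_variables numu f0)//.
apply: ae_eq_integral => //.
- apply: emeasurable_funM => //.
  exact: measurable_int (Radon_Nikodym_SigmaFinite.f_integrable numu).
- exact: emeasurable_funM.
apply: ae_eqe_mul2l.
apply: integral_ae_eq => //.
- exact: Radon_Nikodym_SigmaFinite.f_integrable.
- move=> E _ mE; rewrite -Radon_Nikodym_SigmaFinite.f_integral//.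
  exact: nuE.
Qed.

(** Exponential tilting turns one exponential law into another; all the
    integrals below reduce to this. *)
Lemma exponential_pdfM (x eta : R) : 0 < rate + eta ->
  expR (- eta * x) * exponential_pdf rate x =
  rate / (rate + eta) * exponential_pdf (rate + eta) x.
Proof.
move=> re0; have [x0|x0] := ltP x 0.
  by rewrite !lt0_exponential_pdf// !mulr0.
rewrite !exponential_pdfE// mulrCA -expRD mulrA divfK ?gt_eqF//.
by congr (_ * expR _); ring.
Qed.

Lemma integral_exponential_pdf_le (W : R) : 0 <= W ->
  (\int[mu]_x ((x <= W)%R%:R * exponential_pdf rate x)%:E =
   (1 - expR (- rate * W))%:E)%E.
Proof.
move=> W0; transitivity (exponential_prob rate `[0, W]).
  rewrite /exponential_prob [RHS]integral_mkcond.
  apply: eq_integral => x _; rewrite patchE mem_setE in_itv/=.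
  have [x0|x0] := ltP x 0; first by rewrite lt0_exponential_pdf// mulr0.
  by case: leP; rewrite ?mul1r ?mul0r.
move: W0; rewrite le_eqVlt => /predU1P[<-|W0].
  by rewrite set_itv1 /exponential_prob integral_set1 mulr0 expR0 subrr.
by rewrite exponential_prob_itv0c.
Qed.

Lemma integral_exponential_pdf_gt (W : R) : 0 <= W ->
  (\int[mu]_x ((W < x)%R%:R * exponential_pdf rate x)%:E =
   (expR (- rate * W))%:E)%E.
Proof.
move=> W0.
have mpdf := @measurable_exponential_pdf R rate.
have mle : measurable_fun setT (fun x : R => (x <= W)%R%:R : R).
  apply: (@measurableT_comp _ _ _ _ _ _ (fun b : bool => b%:R : R)) => //.
  exact: measurable_fun_ler.
have mgt : measurable_fun setT (fun x : R => (W < x)%R%:R : R).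
  apply: (@measurableT_comp _ _ _ _ _ _ (fun b : bool => b%:R : R)) => //.
  exact: measurable_fun_ltr.
have pdf0 x : 0 <= exponential_pdf rate x by apply/exponential_pdf_ge0/ltW.
have := @integral_exponential_pdf R rate rate_gt0.
under eq_integral => x _.
  rewrite (_ : exponential_pdf rate x = (x <= W)%R%:R * exponential_pdf rate x
    + (W < x)%R%:R * exponential_pdf rate x); last first.
    by case: leP; rewrite mul1r mul0r ?addr0 ?add0r.
  rewrite EFinD; over.
rewrite ge0_integralD//=; last 4 first.
- by move=> x _; rewrite lee_fin mulr_ge0.
- by apply/measurable_EFinP; exact: measurable_funM.
- by move=> x _; rewrite lee_fin mulr_ge0.
- by apply/measurable_EFinP; exact: measurable_funM.
rewrite integral_exponential_pdf_le// EFinB.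
move: (\int[_]_x _)%E => [r||]//.
by rewrite -EFinB -EFinD => -[] h; congr EFin; lra.
Qed.

End exponential_law.

Section exponential_transforms.
Context (R : realType) (rate : R).
Hypothesis rate_gt0 : 0 < rate.
Local Notation mu := (@lebesgue_measure R).

Lemma exponential_laplace (nu : probability (measurableTypeR R) R) (eta : R) :
  (forall B, measurable B -> nu B = exponential_prob rate B) -> 0 <= eta ->
  (\int[nu]_x (expR (- eta * x))%:E = (rate / (rate + eta))%:E)%E.
Proof.
move=> nuE eta0; have re0 : 0 < rate + eta by rewrite ltr_wpDr.
rewrite (integral_exponential_law nuE)//; last first.
  by apply/measurable_EFinP; apply: measurableT_comp => //;
    exact: mulrl_measurable.
under eq_integral => x _ do rewrite -EFinM exponential_pdfM// EFinM.
rewrite ge0_integralZl_EFin//.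
- by rewrite integral_exponential_pdf// mule1.
- by move=> x _; rewrite lee_fin exponential_pdf_ge0// ltW.
- by apply/measurable_EFinP; exact: measurable_exponential_pdf.
- by rewrite divr_ge0// ltW.
Qed.

(** One step of the workload chain, averaged over the interarrival time [a]; the
    factor [rate / (rate + eta)] is the average over the service time of the new
    customer.  The event [W < a] contributes exp(- (sigma + rate) W).  On its
    complement the integrand is a tilted density of rate
    [mu' = rate + sigma - eta], and contributes
    exp(- eta W) (1 - exp(- mu' W)).  The choice of sigma makes the constant
    factor equal to 1, and the two extra terms cancel since
    eta + mu' = sigma + rate. *)
Lemma workload_step_identity (nu : probability (measurableTypeR R) R)
    (eta W : R) :
  (forall B, measurable B -> nu B = exponential_prob rate B) ->
  0 <= eta -> 0 <= W -> let sigma := eta ^+ 2 / (rate + eta) in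
  (\int[nu]_a (if W < a then expR (- sigma * W)
     else rate / (rate + eta) * expR (- sigma * a - eta * (W - a)))%:E =
   (expR (- eta * W))%:E)%E.
Proof.
move=> nuE eta0 W0 sigma; have re0 : 0 < rate + eta by rewrite ltr_wpDr.
have mpdf r := @measurable_exponential_pdf R r.
have pdf0 r x : 0 <= r -> 0 <= exponential_pdf r x.
  by move=> r0; apply/exponential_pdf_ge0.
pose mu' := rate + (sigma - eta).
have mu'E : mu' = rate ^+ 2 / (rate + eta).
  by rewrite /mu' /sigma; field; rewrite gt_eqF.
have mu'0 : 0 < mu' by rewrite mu'E divr_gt0// exprn_gt0.
have mle : measurable_fun setT (fun x : R => (x <= W)%R%:R : R).
  apply: (@measurableT_comp _ _ _ _ _ _ (fun b : bool => b%:R : R)) => //.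
  exact: measurable_fun_ler.
have mgt : measurable_fun setT (fun x : R => (W < x)%R%:R : R).
  apply: (@measurableT_comp _ _ _ _ _ _ (fun b : bool => b%:R : R)) => //.
  exact: measurable_fun_ltr.
rewrite (integral_exponential_law nuE)//; last 2 first.
- apply/measurable_EFinP; apply: measurable_fun_ifT => //.
    exact: measurable_fun_ltr.
  apply: measurable_funM => //; apply: measurableT_comp => //.
  apply: measurable_funB => //; apply: measurable_funM => //.
  exact: measurable_funB.
- move=> x; rewrite lee_fin; case: ifP => _; first exact: expR_ge0.
  by rewrite mulr_ge0 ?expR_ge0// divr_ge0// ltW.
transitivity (\int[mu]_x
   ((expR (- sigma * W))%:E * ((W < x)%R%:R * exponential_pdf rate x)%:E
   + (expR (- eta * W))%:E * ((x <= W)%R%:R * exponential_pdf mu' x)%:E))%E.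
  apply: eq_integral => x _; rewrite -!EFinM -EFinD; congr EFin.
  case: ltP => _; rewrite ?mul1r ?mul0r ?mulr0 ?addr0 ?add0r//.
  rewrite (_ : - sigma * x - eta * (W - x) = - eta * W + - (sigma - eta) * x);
    last by ring.
  rewrite expRD; set c := rate / (rate + eta).
  set e1 := expR (- eta * W); set e2 := expR (- (sigma - eta) * x).
  rewrite (_ : c * (e1 * e2) * _ = e1 * (c * (e2 * exponential_pdf rate x)));
    last by ring.
  rewrite /e2 exponential_pdfM// -/mu'; congr (_ * _).
  rewrite mulrA (_ : c * _ = 1) ?mul1r//.
  by rewrite mu'E /c; field; rewrite !gt_eqF.
rewrite ge0_integralD//=; last 4 first.
- by move=> x _; rewrite -EFinM lee_fin !mulr_ge0 ?expR_ge0 ?pdf0// ltW.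
- apply: measurable_funeM; apply/measurable_EFinP.
  by apply: measurable_funM => //; exact: mpdf.
- by move=> x _; rewrite -EFinM lee_fin !mulr_ge0 ?expR_ge0 ?pdf0// ltW.
- apply: measurable_funeM; apply/measurable_EFinP.
  by apply: measurable_funM => //; exact: mpdf.
rewrite ge0_integralZl_EFin ?expR_ge0//; last 2 first.
- by move=> x _; rewrite lee_fin !mulr_ge0 ?expR_ge0 ?pdf0// ltW.
- by apply/measurable_EFinP; apply: measurable_funM => //; exact: mpdf.
rewrite ge0_integralZl_EFin ?expR_ge0//; last 2 first.
- by move=> x _; rewrite lee_fin !mulr_ge0 ?expR_ge0 ?pdf0// ltW.
- by apply/measurable_EFinP; apply: measurable_funM => //; exact: mpdf.
rewrite integral_exponential_pdf_gt// integral_exponential_pdf_le//.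
rewrite -!EFinM -EFinD; congr EFin.
rewrite mulrBr mulr1 -!expRD (_ : - sigma * W + _ = - eta * W + - mu' * W).
  by rewrite addrCA subrr addr0.
by rewrite /mu'; ring.
Qed.
End exponential_transforms.

(** * The time to empty of the critical M/M/1 queue *)

Section paths.
Context (R : realType) (k : nat) (a s : nat -> R).
Hypothesis a_gt0 : forall i, 0 < a i.
Hypothesis s_ge0 : forall i, 0 <= s i.

(** Up to the least such [n] the server has never been idle, so that departure
    times are sums of service times, and the departure of customer [n + k - 1]
    leaves the queue empty. *)
Lemma time_to_empty_le n : \sum_(i < n + k) s i < \sum_(i < n.+1) a i ->
  (time_to_empty k a s <= (\sum_(i < n + k) s i)%:E)%E.
Proof.
pose A n := \sum_(i < n) a i; pose S n := \sum_(i < n) s i.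
have A_nd m1 m2 : (m1 <= m2)%N -> A m1 <= A m2.
  move=> /subnK <-; elim: (m2 - m1)%N => // j IH.
  by rewrite addSn /A big_ord_recr/= (le_trans IH)// lerDl ltW.
have S_nd m1 m2 : (m1 <= m2)%N -> S m1 <= S m2.
  move=> /subnK <-; elim: (m2 - m1)%N => // j IH.
  by rewrite addSn /S big_ord_recr/= (le_trans IH)// lerDl.
have exn : \sum_(i < n + k) s i < \sum_(i < n.+1) a i ->
    exists n, S (n + k)%N < A n.+1 by exists n.
move=> /[dup] h /exn {}exn; have [m Sm m_min] := ex_minnP exn.
have mn : (m <= n)%N by exact: m_min.
have dep j : (j < m + k)%N -> departure k a s j <= S j.+1.
  have arr i : (i < m + k)%N -> arrival k a i <= S i.
    move=> im; rewrite /arrival.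
    have [ik|ki] := ltnP i k.
      by rewrite (_ : (i.+1 - k = 0)%N); [rewrite big_ord0 sumr_ge0|lia].
    rewrite subSn// leNgt; apply/negP => Si.
    have : (m <= i - k)%N by apply: m_min; rewrite subnK.
    lia.
  elim: j => [|j IH] jm.
    by rewrite /= /S big_ord_recr/= lerD2r; exact: arr.
  rewrite [departure _ _ _ _]/= /S big_ord_recr/= lerD2r ge_max arr//=.
  by apply: IH; lia.
apply: (@le_trans _ _ (S (m + k)%N)%:E); last first.
  by rewrite lee_fin; apply: S_nd; rewrite leq_add2r.
apply: ereal_inf_lbound; exists (S (m + k)%N) => //; split.
  exact: sumr_ge0.
apply/seteqP; split => // j /andP[arrj depj].
have [jm|mj] := ltnP j (m + k).
  by have := dep _ jm; rewrite leNgt (le_lt_trans _ depj)//; apply: S_nd.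
have : A m.+1 <= arrival k a j by apply: A_nd; lia.
by rewrite leNgt (le_lt_trans arrj).
Qed.

(** The pair is the elapsed time and the workload just after an arrival.  Once
    the workload is 0 it stays so, and the elapsed time is frozen. *)
Definition drain_step (x y : R) (eW : R * R) : R * R :=
  if eW.2 < x then (eW.1 + eW.2, 0) else (eW.1 + x, eW.2 - x + y).

Fixpoint drain (n : nat) : R * R :=
  if n is n'.+1 then drain_step (a n') (s (n' + k)%N) (drain n')
  else (0, \sum_(i < k) s i).

Lemma drain_ge0 n : 0 <= (drain n).1 /\ 0 <= (drain n).2.
Proof.
elim: n => /= [|n [e0 W0]]; first by split => //; exact: sumr_ge0.
rewrite /drain_step; have a0 := ltW (a_gt0 n).
by case: ltP => Wa /=; split=> //; have := s_ge0 (n + k)%N; lra.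
Qed.

(** The first alternative holds during the initial busy period, when the server
    has been working all the time, and the second one from its end on. *)
Lemma drainP n :
  ((drain n).1 + (drain n).2 = \sum_(i < n + k) s i /\
     (drain n).1 = \sum_(i < n) a i) \/
  ((drain n).2 = 0 /\ (time_to_empty k a s <= (drain n).1%:E)%E).
Proof.
elim: n => [|n]; first by left; rewrite /= big_ord0 add0r.
rewrite /= /drain_step => -[[eWE eE]|[-> te]]; last first.
  by rewrite a_gt0 /= !addr0; right.
case: ltP => [Wa|aW] /=.
  right; split=> //; rewrite eWE; apply: time_to_empty_le.
  by rewrite -eWE big_ord_recr/= -eE ltrD2l.
by left; rewrite addSn !big_ord_recr/= -eWE eE; split => //; ring.
Qed.

End paths.

Section time_to_empty_law.
Context (R : realType) (lam : R) (k : nat) d (Omega : measurableType d).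
Context (P : probability Omega R).
Context (Y : nat + nat -> {RV P >-> measurableTypeR R}).
Hypothesis lam_gt0 : 0 < lam.
Hypothesis indY : mutually_independent P (fun i => Y i : Omega -> R).
Hypothesis lawY : forall i B, measurable B ->
  distribution P (Y i) B = exponential_prob lam B.

Let Yf (i : nat + nat) : Omega -> R := Y i.
Let a (w : Omega) i : R := Y (inl i) w.
Let s (w : Omega) m : R := Y (inr m) w.

Let mY i : measurable_fun setT (Yf i).
Proof. exact: (measurable_funP (Y i)). Qed.

Let ae_gt0 i : {ae P, forall w, 0 < Yf i w}.
Proof.
exists (Yf i @^-1` `]-oo, 0]); split.
- by rewrite -[X in measurable X]setTI; exact: mY.
- transitivity (distribution P (Y i) `]-oo, 0]); first by [].
  rewrite lawY// /exponential_prob.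
  rewrite -integral_itv_bndo_bndc//; last first.
    apply/measurable_EFinP/measurable_funTS.
    exact: measurable_exponential_pdf.
  apply: integral0_eq => x; rewrite /= in_itv/= => x0.
  by rewrite lt0_exponential_pdf.
- by move=> w /= /negP; rewrite -leNgt in_itv.
Qed.

Let ae_all_gt0 :
  {ae P, forall w, (forall i, 0 < a w i) /\ forall m, 0 <= s w m}.
Proof.
have h1 : {ae P, forall w n, 0 < Yf (inl n) w}.
  by apply: ae_foralln => n; exact: ae_gt0.
have h2 : {ae P, forall w n, 0 < Yf (inr n) w}.
  by apply: ae_foralln => n; exact: ae_gt0.
by apply: filterS2 h1 h2 => w w1 w2; split => // m; exact/ltW/w2.
Qed.

(** The variables on which the state after [n] steps depends. *)
Let hist n : seq (nat + nat) := map inl (iota 0 n) ++ map inr (iota 0 (n + k)).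

Let uniq_hist n : uniq (inl n :: hist n).
Proof.
rewrite /= mem_cat mem_map; last by move=> x y [].
rewrite mem_iota ltnn/= cat_uniq !map_inj_uniq ?iota_uniq//=; last 2 first.
- by move=> x y [].
- by move=> x y [].
rewrite andbT; apply/andP; split; first by apply/mapP => -[].
by apply/hasPn => _ /mapP[m _ ->]; apply/mapP => -[].
Qed.

Let uniq_hist' n : uniq (inr (n + k)%N :: inl n :: hist n).
Proof.
rewrite cons_uniq uniq_hist andbT inE/= mem_cat mem_map; last by move=> x y [].
by rewrite mem_iota/= add0n ltnn orbF; apply/mapP => -[].
Qed.

Let inl_hist n i : (i < n)%N -> inl i \in hist n.
Proof. by move=> ni; rewrite mem_cat map_f// mem_iota. Qed.

Let inr_hist n m : (m < n + k)%N -> inr m \in hist n.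
Proof. by move=> ni; rewrite mem_cat orbC map_f// mem_iota. Qed.

Lemma measurable_drain_step d' (T : measurableType d') (x y : T -> R)
    (u : T -> R * R) :
  measurable_fun setT x -> measurable_fun setT y -> measurable_fun setT u ->
  measurable_fun setT (fun w => drain_step (x w) (y w) (u w)).
Proof.
move=> mx my mu; rewrite /drain_step.
have mu1 : measurable_fun setT (fun w => (u w).1) by exact: measurableT_comp.
have mu2 : measurable_fun setT (fun w => (u w).2) by exact: measurableT_comp.
apply: measurable_fun_ifT; first exact: measurable_fun_ltr.
- apply: measurable_fun_pair => //; exact: measurable_funD.
- apply: measurable_fun_pair; first exact: measurable_funD.
  by apply: measurable_funD => //; exact: measurable_funB.
Qed.

Let measurable_drain n (q : seq (nat + nat)) :
  (forall i, (i < n)%N -> inl i \in q) ->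
  (forall m, (m < n + k)%N -> inr m \in q) ->
  measurable_fun setT
    (fun w : observed Yf q => drain k (a w) (s w) n).
Proof.
elim: n => [|n IH] qa qs.
  apply: measurable_fun_pair => //=.
  apply: measurable_sum => m; apply: observed_measurable_fun => //.
  by apply: qs; rewrite add0n.
rewrite /=; apply: measurable_drain_step.
- apply: observed_measurable_fun => //; exact: qa.
- apply: observed_measurable_fun => //; apply: qs; exact: ltnSn.
- by apply: IH => i h; [apply: qa|apply: qs]; rewrite ltnW.
Qed.


Let lawYP i B : measurable B -> P (Yf i @^-1` B) = exponential_prob lam B.
Proof. exact: lawY. Qed.

Section laplace_functional.
Context (eta : R) (eta_ge0 : 0 <= eta).

Let sigma := eta ^+ 2 / (lam + eta).

Let J (u : R * R) : R := expR (- sigma * u.1 - eta * u.2).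

Let J_ge0 u : (0 <= (J u)%:E)%E. Proof. by rewrite lee_fin expR_ge0. Qed.

Let measurable_J d' (T : measurableType d') (u : T -> R * R) :
  measurable_fun setT u -> measurable_fun setT (fun w => (J (u w))%:E).
Proof.
move=> mu; apply/measurable_EFinP; rewrite /J.
apply: (@measurableT_comp _ _ _ _ _ _ (@expR R)) => //.
by apply: measurable_funB; apply: measurable_funM => //; exact: measurableT_comp.
Qed.

(** The mean of exp(- sigma e - eta W) is constant along the workload chain:
    integrate out first the service time, then the interarrival time. *)
Lemma integral_drainS n :
  (\int[P]_w (J (drain k (a w) (s w) n.+1))%:E =
   \int[P]_w (J (drain k (a w) (s w) n))%:E)%E.
Proof.
pose h1 (z : observed Yf (inl n :: hist n) * measurableTypeR R) :=
  (J (drain_step (a z.1 n) z.2 (drain k (a z.1) (s z.1) n)))%:E.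
have mh1 : measurable_fun setT h1.
  apply: measurable_J; apply: measurable_drain_step.
  - apply: (@measurableT_comp _ _ _ _ _ _
      (Yf (inl n) : observed Yf (inl n :: hist n) -> R)) => //.
    by apply: observed_measurable_fun => //; exact: mem_head.
  - exact: measurable_snd.
  - apply: (@measurableT_comp _ _ _ _ _ _
      (fun w : observed Yf (inl n :: hist n) => drain k (a w) (s w) n)) => //.
    apply: measurable_drain => i im; rewrite inE ?inl_hist ?inr_hist ?orbT//.
transitivity (\int[P]_w h1 (w, Yf (inr (n + k)%N) w))%E; first by [].
rewrite (integral_observed mY indY (uniq_hist' n)
  (nu := distribution P (Y (inr (n + k)%N))))//; last by move=> z; exact: J_ge0.
pose c := lam / (lam + eta).
pose h2 (z : observed Yf (hist n) * measurableTypeR R) :=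
  let: u := drain k (a z.1) (s z.1) n in
  (if u.2 < z.2 then expR (- sigma * (u.1 + u.2)) else
   c * expR (- sigma * (u.1 + z.2) - eta * (u.2 - z.2)))%:E.
have c0 : 0 <= c by rewrite divr_ge0 ?addr_ge0// ltW.
have h20 z : (0 <= h2 z)%E.
  rewrite /h2 lee_fin; case: ifP => _; first exact: expR_ge0.
  by rewrite mulr_ge0 ?expR_ge0.
have mdrain : measurable_fun setT
    (fun z : observed Yf (hist n) * measurableTypeR R =>
       drain k (a z.1) (s z.1) n).
  apply: (@measurableT_comp _ _ _ _ _ _
    (fun w : observed Yf (hist n) => drain k (a w) (s w) n)) => //.
  by apply: measurable_drain => i im; rewrite ?inl_hist ?inr_hist.
have mh2 : measurable_fun setT h2.
  apply/measurable_EFinP.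
  have m1 := measurableT_comp measurable_fst mdrain.
  have m2 := measurableT_comp measurable_snd mdrain.
  apply: measurable_fun_ifT; first exact: measurable_fun_ltr.
  - apply: measurableT_comp => //; apply: measurable_funM => //.
    exact: measurable_funD.
  - apply: measurable_funM => //.
    apply: (@measurableT_comp _ _ _ _ _ _ (@expR R)) => //.
    apply: measurable_funB; apply: measurable_funM => //.
      exact: measurable_funD.
    exact: measurable_funB.
transitivity (\int[P]_w h2 (w, Yf (inl n) w))%E.
  apply: eq_integral => w _; rewrite /h1 /h2 /= /drain_step /a /Yf.
  case: ifP => _.
    rewrite integral_cst// [X in (_ * X)%E](_ : _ = 1%E).
      by rewrite mule1 /J mulr0 subr0.
    exact: probability_setT.
  move: (drain k _ _ n) (Y (inl n) w : R) => [e W] x /=.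
  transitivity (\int[distribution P (Y (inr (n + k)%N))]_v
      ((expR (- sigma * (e + x) - eta * (W - x)))%:E * (expR (- eta * v))%:E))%E.
    apply: eq_integral => v _; rewrite /J /= -EFinM -expRD.
    by congr (expR _)%:E; ring.
  rewrite ge0_integralZl_EFin ?expR_ge0//; last first.
    by apply/measurable_EFinP; apply: measurableT_comp => //;
      exact: mulrl_measurable.
  rewrite (exponential_laplace lam_gt0)//; last exact: lawY.
  by rewrite -EFinM mulrC.
rewrite (integral_observed mY indY (uniq_hist n)
  (nu := distribution P (Y (inl n))))//.
apply: ge0_ae_eq_integral => //.
- apply: (@measurable_fun_observed _ _ _ _ _ mY (hist n)).
  exact: measurable_fun_fubini_tonelli_F.
- apply: (@measurable_fun_observed _ _ _ _ _ mY (hist n)).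
  by apply: measurable_J; apply: measurable_drain => i im;
      rewrite ?inl_hist ?inr_hist.
- by move=> w _; exact: integral_ge0.
apply: filterS ae_all_gt0 => w [w1 w2] _.
have [_ W0] := drain_ge0 k w1 w2 n.
rewrite /h2 /=; move: W0; move: (drain k _ _ n) => [e W] /= W0.
transitivity (\int[distribution P (Y (inl n))]_v ((expR (- sigma * e))%:E *
   (if W < v then expR (- sigma * W)
     else c * expR (- sigma * v - eta * (W - v)))%:E))%E.
  apply: eq_integral => v _; rewrite -EFinM; congr EFin.
  case: ifP => _; first by rewrite -expRD; congr expR; ring.
  by rewrite mulrCA -expRD; congr (_ * expR _); ring.
rewrite ge0_integralZl_EFin ?expR_ge0//; last 2 first.
- move=> v _; rewrite lee_fin; case: ifP => _; first exact: expR_ge0.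
  by rewrite mulr_ge0 ?expR_ge0.
- apply/measurable_EFinP; apply: measurable_fun_ifT => //.
    exact: measurable_fun_ltr.
  apply: measurable_funM => //.
  apply: (@measurableT_comp _ _ _ _ _ _ (@expR R)) => //.
  apply: measurable_funB => //; apply: measurable_funM => //.
  exact: measurable_funB.
rewrite (workload_step_identity lam_gt0)//; last exact: lawY.
by rewrite -EFinM -expRD /J /=; congr (expR _)%:E; ring.
Qed.

Lemma integral_services_laplace m :
  (\int[P]_w (expR (- eta * \sum_(i < m) s w i))%:E =
   ((lam / (lam + eta)) ^+ m)%:E)%E.
Proof.
elim: m => [|m IH].
  under eq_integral do rewrite big_ord0 mulr0 expR0.
  by rewrite integral_cst// mul1e; exact: probability_setT.
pose q : seq (nat + nat) := map inr (iota 0 m).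
have uq : uniq (inr m :: q).
  rewrite /= mem_map; last by move=> x y [].
  by rewrite mem_iota/= add0n ltnn map_inj_uniq ?iota_uniq// => x y [].
pose h (z : observed Yf q * measurableTypeR R) :=
  (expR (- eta * (\sum_(i < m) s z.1 i + z.2)))%:E.
have ms : measurable_fun setT (fun w : observed Yf q => \sum_(i < m) s w i).
  apply: measurable_sum => i; apply: observed_measurable_fun => //.
  by apply: map_f; rewrite mem_iota add0n /=.
have mh : measurable_fun setT h.
  apply/measurable_EFinP; apply: measurableT_comp => //.
  apply: measurable_funM => //.
  apply: measurable_funD => //.
  exact: (measurableT_comp ms).
transitivity (\int[P]_w h (w, Yf (inr m) w))%E.
  by apply: eq_integral => w _; rewrite big_ord_recr.
rewrite (integral_observed mY indY uq (nu := distribution P (Y (inr m))))//;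
  last by move=> z; rewrite lee_fin expR_ge0.
transitivity (\int[P]_w ((expR (- eta * \sum_(i < m) s w i))%:E *
    (lam / (lam + eta))%:E))%E.
  apply: eq_integral => w _; rewrite /h /=.
  under eq_integral do rewrite mulrDr expRD EFinM.
  rewrite ge0_integralZl_EFin ?expR_ge0//; last first.
    by apply/measurable_EFinP; apply: measurableT_comp => //;
      exact: mulrl_measurable.
  by rewrite (exponential_laplace lam_gt0)//; exact: lawY.
rewrite ge0_integralZr//; last 2 first.
- apply: (@measurable_fun_observed _ _ _ _ _ mY q).
  apply/measurable_EFinP; apply: measurableT_comp => //; exact: measurable_funM.
- by rewrite lee_fin divr_ge0 ?addr_ge0// ltW.
by rewrite IH -EFinM exprSr.
Qed.

Lemma integral_drain n :
  (\int[P]_w (J (drain k (a w) (s w) n))%:E = ((lam / (lam + eta)) ^+ k)%:E)%E.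
Proof.
elim: n => [|n IH]; last by rewrite integral_drainS.
rewrite -integral_services_laplace; apply: eq_integral => w _.
by rewrite /J /= mulr0 add0r mulNr.
Qed.

(** Outside of this event some service time, and hence the sum of elapsed time
    and workload if the queue has not emptied, exceeds [t]. *)
Lemma small_services t m : 0 <= t ->
  P [set w | forall i, (i < m)%N -> s w i <= t] =
  ((1 - expR (- lam * t)) ^+ m)%:E.
Proof.
move=> t0.
have -> : [set w | forall i, (i < m)%N -> s w i <= t] =
    [set w | forall i, i \in (map inr (iota 0 m) : seq (nat + nat)) ->
      `]-oo, t]%classic (Yf i w)].
  apply/seteqP; split => w /= h i.
    by move=> /mapP[j]; rewrite mem_iota in_itv => /h + ->.
  move=> im; have := h (inr i); rewrite map_f ?mem_iota// in_itv/=; exact.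
rewrite (indY (s := map inr (iota 0 m)) (B := fun=> `]-oo, t]%classic))//;
  last first.
  by rewrite map_inj_uniq ?iota_uniq// => x y [].
under eq_bigr do rewrite (lawYP _ (measurable_itv _)).
rewrite (_ : exponential_prob _ _ = (1 - expR (- lam * t))%:E); last first.
  rewrite -integral_exponential_pdf_le// /exponential_prob integral_mkcond.
  apply: eq_integral => x _; rewrite patchE mem_setE in_itv/=.
  by case: leP; rewrite ?mul1r ?mul0r.
rewrite prodEFin big_map.
by rewrite big_const_seq count_predT size_iota iter_mulr_1.
Qed.

Let measurable_small t m :
  measurable [set w | forall i, (i < m)%N -> s w i <= t].
Proof.
rewrite (_ : [set w | _] = \bigcap_(i in `I_m) Yf (inr i) @^-1` `]-oo, t]).
  apply: bigcap_measurableType => i _.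
  by rewrite -[X in measurable X]setTI; exact: mY.
apply/seteqP; split => w /= h i im; first by rewrite /= in_itv/=; exact: h.
by have := h i im; rewrite /= in_itv.
Qed.

Let integral_drain_le (Z : {RV P >-> measurableTypeR R}) (t : R) n :
  0 <= t ->
  {ae P, forall w, (Z w)%:E = time_to_empty k (a w) (s w)} ->
  ((lam / (lam + eta)) ^+ k <=
   1 - (1 - expR (- sigma * t)) * fine (P (Z @^-1` `]t, +oo[)) +
   (1 - expR (- lam * t)) ^+ (n + k)).
Proof.
move=> t0 ZE; set H := Z @^-1` _.
have mH : measurable H.
  by rewrite -[X in measurable X]setTI; exact: (measurable_funP Z).
set G := [set w | forall i, (i < n + k)%N -> s w i <= t].
have mG : measurable G by exact: measurable_small.
have lam_eta : 0 < lam + eta by rewrite ltr_wpDr.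
have sigma0 : 0 <= sigma by rewrite /sigma divr_ge0 ?exprn_ge0// ltW.
have sigma_eta : sigma <= eta.
  rewrite /sigma ler_pdivrMr// expr2 ler_wpM2l// lerDr ltW//.
pose f w : \bar R := ((expR (- sigma * t))%:E * (\1_H w)%:E + (\1_(~` H) w)%:E +
  (\1_G w)%:E)%E.
have f0 w : (0 <= f w)%E.
  by rewrite /f -EFinM -!EFinD lee_fin !addr_ge0 ?mulr_ge0 ?expR_ge0.
have mind A : measurable A ->
    measurable_fun setT (fun w : Omega => (\1_A w)%:E : \bar R).
  by move=> mA; apply/measurable_EFinP; exact: measurable_indic.
have mf : measurable_fun setT f.
  apply: emeasurable_funD; last exact: mind.
  apply: emeasurable_funD; last by apply: mind; exact: measurableC.
  by apply: measurable_funeM; exact: mind.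
have : (\int[P]_w (J (drain k (a w) (s w) n))%:E <= \int[P]_w f w)%E.
  apply: ae_ge0_le_integral => //.
  - apply: (@measurable_fun_observed _ _ _ _ _ mY (hist n)).
    by apply: measurable_J; apply: measurable_drain => i im;
      rewrite ?inl_hist ?inr_hist.
  apply: filterS2 ae_all_gt0 ZE => w [w1 w2] Zw _.
  have [e0 W0] := drain_ge0 k w1 w2 n.
  have J1 : J (drain k (a w) (s w) n) <= 1.
    rewrite /J -expR0 ler_expR mulNr -opprD oppr_le0.
    by rewrite addr_ge0// mulr_ge0.
  have Je x : x <= (drain k (a w) (s w) n).1 + (drain k (a w) (s w) n).2 ->
      J (drain k (a w) (s w) n) <= expR (- sigma * x).
    move=> xeW; rewrite /J ler_expR mulNr -opprD mulNr lerN2.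
    apply: (@le_trans _ _
      (sigma * ((drain k (a w) (s w) n).1 + (drain k (a w) (s w) n).2))).
      exact: ler_wpM2l.
    by rewrite mulrDr lerD2l ler_wpM2r.
  rewrite /f -EFinM -!EFinD lee_fin.
  have [wG|wG] := pselect (G w).
    rewrite [\1_G w]indicE mem_set// (le_trans J1)// lerDr.
    by rewrite addr_ge0// mulr_ge0 ?expR_ge0.
  rewrite !indicE (memNset wG) addr0.
  have [wH|wH] := pselect (H w); last first.
    by rewrite memNset// mem_set// mulr0 add0r.
  rewrite mem_set// (memNset (_ : ~ (~` H) w)); last exact.
  rewrite mulr1 addr0; apply: Je.
  have [[eW _]|[W00 te]] := drainP k w1 w2 n.
    rewrite eW; apply: contrapT => /negP; rewrite -ltNge => St.
    apply: wG => i im.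
    rewrite (le_trans _ (ltW St))// (bigD1 (Ordinal im))//= lerDl.
    by apply: sumr_ge0.
  rewrite W00 addr0 ltW//.
  move: te; rewrite -Zw lee_fin; apply: lt_le_trans.
  by move: wH; rewrite /H /= in_itv/= andbT.
have HG0 w : (0 <= (expR (- sigma * t))%:E * (\1_H w)%:E :> \bar R)%E.
  by rewrite -EFinM lee_fin mulr_ge0 ?expR_ge0.
have mHG : measurable_fun setT
    (fun w => (expR (- sigma * t))%:E * (\1_H w)%:E : \bar R)%E.
  by apply: measurable_funeM; exact: mind.
have mHC : measurable_fun setT (fun w => (\1_(~` H) w)%:E : \bar R).
  by apply: mind; exact: measurableC.
rewrite integral_drain ge0_integralD//; last 3 first.
- by move=> w _; rewrite adde_ge0// lee_fin.
- exact: emeasurable_funD.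
- exact: mind.
have iH : (\int[P]_w (\1_H w)%:E = P H)%E by rewrite integral_indic// setIT.
have iHC : (\int[P]_w (\1_(~` H) w)%:E = 1 - P H)%E.
  rewrite integral_indic ?setIT; [|by []|exact: measurableC].
  exact: probability_setC.
have iG : (\int[P]_w (\1_G w)%:E = ((1 - expR (- lam * t)) ^+ (n + k))%:E)%E.
  by rewrite integral_indic ?setIT//; exact: small_services.
rewrite ge0_integralD// ge0_integralZl_EFin ?expR_ge0//; last exact: mind.
rewrite iH iHC iG.
rewrite -(fineK (fin_num_measure P H mH)) -EFinM -EFinB -!EFinD lee_fin => h.
by apply: (le_trans h); rewrite lerD2r; lra.
Qed.

(** Markov's inequality for 1 - exp(- sigma Z), in the limit of infinitely many
    steps of the workload chain. *)
Lemma time_to_empty_laplace (Z : {RV P >-> measurableTypeR R}) (t : R) :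
  0 <= t ->
  {ae P, forall w, (Z w)%:E = time_to_empty k (a w) (s w)} ->
  (1 - expR (- sigma * t)) * fine (P (Z @^-1` `]t, +oo[)) <=
    1 - (lam / (lam + eta)) ^+ k.
Proof.
move=> t0 ZE; set p := fine _; rewrite lerBrDr -lerBrDl.
pose r := 1 - expR (- lam * t).
have r01 : `|r| < 1.
  have e1 : expR (- lam * t) <= 1.
    by rewrite -expR0 ler_expR mulNr oppr_le0 mulr_ge0// ltW.
  have := expR_gt0 (- lam * t).
  by rewrite /r ger0_norm ?subr_ge0// => ?; lra.
have cr : (fun n => (1 - (1 - expR (- sigma * t)) * p) + r ^+ n) @ \oo -->
    (1 - (1 - expR (- sigma * t)) * p + 0).
  by apply: cvgD; [exact: cvg_cst|exact: cvg_expr].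
rewrite addr0 in cr.
apply: (ler_cvg_to (cvg_cst _) cr); apply: nearW => n.
apply: (le_trans (integral_drain_le n t0 ZE)); rewrite -/p lerD2l.
have r0 : 0 <= r.
  by rewrite subr_ge0 -expR0 ler_expR mulNr oppr_le0 mulr_ge0// ltW.
rewrite exprD ler_piMr ?exprn_ge0// exprn_ile1//.
Qed.
End laplace_functional.
End time_to_empty_law.

(** With t = 2 lam / eta^2 the bound reads 2 k sqrt (2 / (lam t)); the parameter
    [eta] stands for the square root. *)
Lemma mm1_time_to_empty_tail (R : realType) (lam eta t : R) (k : nat)
    (nu : probability (measurableTypeR R) R) :
  mm1_time_to_empty_law lam lam k nu -> 0 < eta -> eta <= lam ->
  2 * lam / eta ^+ 2 <= t ->
  (nu `]t, +oo[%classic <= (k%:R * (2 * eta / lam))%:E)%E.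
Proof.
case=> d [Om [P [Y [Z [indY lawa laws ZE nuE]]]]] eta0 eta_lam tE.
have lam0 : 0 < lam by exact: lt_le_trans eta_lam.
have t0 : 0 <= t.
  by apply: le_trans tE; rewrite divr_ge0 ?exprn_ge0 ?mulr_ge0// ltW.
have lawY i B : measurable B -> distribution P (Y i) B = exponential_prob lam B.
  by case: i => i mB; [exact: lawa|exact: laws].
have := time_to_empty_laplace lam0 indY lawY (ltW eta0) t0 ZE.
rewrite nuE; last exact: measurable_itv.
set p := fine _ => h.
rewrite (_ : distribution P Z _ = p%:E); last first.
  rewrite /p fineK//; apply: fin_num_measure.
  by rewrite -[X in measurable X]setTI; exact: (measurable_funP Z).
rewrite lee_fin.
have p0 : 0 <= p by exact: fine_ge0.
have lam_eta : 0 < lam + eta by rewrite addr_gt0.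
have bernoulli : 1 - (lam / (lam + eta)) ^+ k <= k%:R * (eta / lam).
  set c := lam / (lam + eta).
  have c0 : 0 <= c by rewrite divr_ge0// ltW.
  have c1 : c <= 1 by rewrite ler_pdivrMr// mul1r lerDl ltW.
  have cE : 1 - c <= eta / lam.
    rewrite (_ : 1 - c = eta / (lam + eta)); last first.
      by rewrite /c; field; rewrite gt_eqF.
    by rewrite ler_pM2l// lef_pV2 ?posrE// lerDl ltW.
  elim: k {indY lawa laws ZE h} => [|j IH]; first by rewrite expr0 subrr mul0r.
  rewrite exprS -natr1 mulrDl mul1r.
  rewrite (_ : 1 - c * c ^+ j = c * (1 - c ^+ j) + (1 - c)); last by ring.
  apply: lerD => //; apply: le_trans IH; apply: ler_piMl => //.
  by rewrite subr_ge0 exprn_ile1.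
have half : 2^-1 <= 1 - expR (- (eta ^+ 2 / (lam + eta)) * t).
  have st : 1 <= eta ^+ 2 / (lam + eta) * t.
    apply: (@le_trans _ _ (eta ^+ 2 / (lam + eta) * (2 * lam / eta ^+ 2))).
      rewrite (_ : _ * _ = 2 * lam / (lam + eta)).
        by rewrite ler_pdivlMr// mul1r; lra.
      by field; rewrite !gt_eqF.
    by rewrite ler_wpM2l// divr_ge0 ?exprn_ge0// ltW.
  have : expR (- (eta ^+ 2 / (lam + eta)) * t) <= 2^-1.
    apply: (@le_trans _ _ (expR (- 1))).
      by rewrite ler_expR mulNr lerN2.
    rewrite expRN lef_pV2 ?posrE ?expR_gt0//.
    by apply: le_trans (expR_ge1Dx 1); rewrite -natr1.
  by lra.
have hp : 2^-1 * p <= k%:R * (eta / lam).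
  apply: le_trans bernoulli; apply: le_trans h; exact: ler_wpM2r.
rewrite (_ : _ * _ = 2 * (k%:R * (eta / lam))); last by ring.
by lra.
Qed.

(** * One step of the greedy server *)

Section poisson_mass.
Context (R : realType).
Implicit Types (kappa lam : R) (m j : nat).

Lemma poisson_mass_ge0 kappa j : 0 <= poisson_mass kappa j.
Proof. by rewrite /poisson_mass; case: ifP => // _; exact: poisson_pmf_ge0. Qed.

Lemma poisson_mass_le0 kappa j :
  kappa <= 0 -> poisson_mass kappa j = (j == 0%N)%:R.
Proof. by move=> k0; rewrite /poisson_mass ltNge k0. Qed.

Lemma sum_poisson_mass kappa :
  (\sum_(0 <= j <oo) (poisson_mass kappa j)%:E = 1)%E.
Proof.
have [k0|k0] := leP kappa 0.
  rewrite nneseries_recl//; last by move=> j _; rewrite lee_fin poisson_mass_ge0.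
  rewrite poisson_mass_le0//= eseries0 ?adde0// => j j0 _.
  by rewrite poisson_mass_le0// gtn_eqF.
have : poisson_prob kappa 0 [set: nat] = 1%E.
  exact: (@probability_setT _ _ _ (poisson_prob kappa 0)).
rewrite /poisson_prob k0 => <-.
rewrite nneseries_esumT; last by move=> j; rewrite lee_fin poisson_mass_ge0.
by apply: eq_esum => j _; rewrite /poisson_mass k0.
Qed.

Lemma poisson_mass_mean kappa :
  (\sum_(0 <= j <oo) (j%:R * poisson_mass kappa j)%:E = (Num.max 0 kappa)%:E)%E.
Proof.
rewrite nneseries_recl//; last first.
  by move=> j _; rewrite lee_fin mulr_ge0// poisson_mass_ge0.
rewrite mul0r add0e.
have [k0|k0] := leP kappa 0.
  rewrite eseries0// => j j0 _.
  by rewrite poisson_mass_le0// gtn_eqF// mulr0.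
rewrite -nneseries_addn; last first.
  by move=> j; rewrite lee_fin mulr_ge0// poisson_mass_ge0.
transitivity (\sum_(0 <= j <oo) (kappa%:E * (poisson_mass kappa j)%:E))%E.
  apply: eq_eseriesr => j _; rewrite -EFinM; congr EFin.
  rewrite /poisson_mass k0 /poisson_pmf k0 addn1 factS natrM exprS invfM.
  have j1 : j.+1%:R != 0 :> R by rewrite pnatr_eq0.
  have jf : j`!%:R != 0 :> R by rewrite pnatr_eq0 -lt0n fact_gt0.
  by move: j.+1%:R j`!%:R j1 jf => x y x0 y0; field; rewrite x0 y0.
rewrite nneseriesZl ?sum_poisson_mass ?mule1//.
by move=> j _; rewrite lee_fin poisson_mass_ge0.
Qed.

Lemma poisson_mass_shifted_mean kappa m :
  (\sum_(0 <= j <oo) ((m + j)%:R * poisson_mass kappa j)%:E =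
   (m%:R + Num.max 0 kappa)%:E)%E.
Proof.
under eq_eseriesr do rewrite natrD mulrDl EFinD EFinM.
rewrite nneseriesD; last 2 first.
- by move=> j _ _; rewrite -EFinM lee_fin mulr_ge0// poisson_mass_ge0.
- by move=> j _ _; rewrite lee_fin mulr_ge0// poisson_mass_ge0.
rewrite nneseriesZl ?sum_poisson_mass ?mule1 ?poisson_mass_mean//.
by move=> j _; rewrite lee_fin poisson_mass_ge0.
Qed.

(** A queue grows by at most the number of arrivals until the end of the step,
    whether it is known already, newly inspected or just emptied. *)
Lemma entry_law_mean lam (q : int -> option nat) (x k : int) (tau t b : R) :
  0 < lam -> 0 <= b -> tau <= b -> t <= b ->
  (\sum_(0 <= j <oo) (j%:R * entry_law lam q x tau t k (Some j))%:E <=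
   ((odflt 0%N (q k))%:R + lam * b)%:E)%E.
Proof.
move=> lam0 b0 taub tb.
have lamb0 : 0 <= lam * b by rewrite mulr_ge0// ltW.
have max_le c : c <= b -> Num.max 0 (lam * c) <= lam * b.
  by move=> cb; rewrite ge_max lamb0 ler_wpM2l// ltW.
have zero (f : nat -> R) : (forall j, f j = 0) ->
    (\sum_(0 <= j <oo) (f j)%:E <= ((odflt 0%N (q k))%:R + lam * b)%:E)%E.
  by move=> f0; rewrite eseries0 ?lee_fin ?addr_ge0// => j _ _; rewrite f0.
rewrite /entry_law; case: eqP => _.
  by apply: zero => -[|j]; rewrite ?mul0r// mulr0.
move: zero; case: (q k) => [m|] zero; last first.
  case: ((k == x + 1) || (k == x - 1)); last by apply: zero => j; rewrite mulr0.
  by rewrite poisson_mass_mean add0r lee_fin max_le.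
rewrite (nneseries_split 0%N m); last first.
  move=> j _; rewrite lee_fin mulr_ge0//.
  by case: ifP => // _; exact: poisson_mass_ge0.
rewrite add0n big1_seq ?add0e; last first.
  by move=> j /=; rewrite mem_index_iota => /andP[_ jm]; rewrite leqNgt jm mulr0.
rewrite -nneseries_addn; last first.
  move=> j; rewrite lee_fin mulr_ge0//.
  by case: ifP => // _; exact: poisson_mass_ge0.
under eq_eseriesr do rewrite leq_addl addnK addnC.
by rewrite poisson_mass_shifted_mean lee_fin lerD2l max_le.
Qed.

Lemma step_time_law_tail lam (zeta : nat -> probability (measurableTypeR R) R)
    (eta t : R) (m : nat) :
  (forall k, mm1_time_to_empty_law lam lam k (zeta k)) ->
  0 < eta -> eta <= lam -> 1 + 2 * lam / eta ^+ 2 <= t ->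
  (step_time_law lam zeta m `]t, +oo[%classic <=
   ((m%:R + lam) * (2 * eta / lam))%:E)%E.
Proof.
move=> zetaP eta0 eta_lam tE.
have lam0 : 0 < lam by exact: lt_le_trans eta_lam.
have c0 : 0 <= 2 * eta / lam by rewrite divr_ge0// ?mulr_ge0// ltW.
apply: (@le_trans _ _ (\sum_(0 <= j <oo)
    ((2 * eta / lam)%:E * ((m + j)%:R * poisson_mass lam j)%:E))%E).
  apply: lee_nneseries => j.
    by move=> _ _; rewrite mule_ge0// lee_fin poisson_mass_ge0.
  move=> _; rewrite -EFinM mulrA [leRHS](_ : _ =
    ((poisson_mass lam j)%:E * ((m + j)%:R * (2 * eta / lam))%:E)%E); last first.
    by rewrite -EFinM; congr EFin; ring.
  apply: lee_wpmul2l; first by rewrite lee_fin poisson_mass_ge0.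
  rewrite (_ : [set u | _] = `]t - 1, +oo[%classic).
    by apply: (mm1_time_to_empty_tail (zetaP _)) => //; lra.
  by apply/seteqP; split => u /=; rewrite !in_itv/= !andbT => h; lra.
rewrite nneseriesZl; last first.
  by move=> j _; rewrite lee_fin mulr_ge0// poisson_mass_ge0.
by rewrite poisson_mass_shifted_mean -EFinM max_r 1?mulrC// ltW.
Qed.

End poisson_mass.

(** * The thresholds *)

Section thresholds.
Context (R : realType) (lam gam l : R) (n : nat).
Hypothesis lam_gt0 : 0 < lam.
Hypothesis gam_gt2 : 2 < gam.
Hypothesis l_ge2 : 2 <= l.
Hypothesis l_lam : (1 + 4 * lam) / lam <= l.

(** [eta] is, up to a constant, the inverse square root of [b'], which is what
    the tail bound on the time to empty asks for at times of order [b'].  The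
    constant [1 + 4 * lam] only has to have a square of at least [8 * lam]. *)
Let b := expR (l * gam ^+ n).
Let b' := expR (l * gam ^+ n.+1).
Let eta := (1 + 4 * lam) * expR (- (l * gam ^+ n.+1 / 2)).

Let gam_ge (m : nat) : 2 ^+ m <= gam ^+ m.
Proof. by rewrite lerXn2r ?nnegrE ?ltW// (lt_trans _ gam_gt2). Qed.

Let c_gt0 : 0 < 1 + 4 * lam. Proof. by rewrite addr_gt0// mulr_gt0. Qed.

Let b_ge3 : 3 <= b.
Proof.
have l2 := l_ge2; have g2 := gam_gt2.
apply: (@le_trans _ _ (1 + l * gam ^+ n)); last exact: expR_ge1Dx.
have g0 : 1 <= gam by lra.
have g1 : 1 <= gam ^+ n by exact: exprn_ege1.
have lg : l * 1 <= l * gam ^+ n by rewrite ler_wpM2l//; lra.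
by lra.
Qed.

Let b'_ge : b ^+ 2 <= b'.
Proof.
have l2 := l_ge2; have g2 := gam_gt2.
rewrite /b /b' -expRM_natr ler_expR -mulrA ler_wpM2l//; first lra.
rewrite exprSr ler_wpM2l ?ltW// exprn_gt0//; lra.
Qed.

Lemma threshold_eta_gt0 : 0 < eta.
Proof. by rewrite mulr_gt0 ?expR_gt0. Qed.

Lemma threshold_eta_le : eta <= lam.
Proof.
have l2 := l_ge2.
rewrite /eta expRN ler_pdivrMr ?expR_gt0//.
rewrite -ler_pdivrMl// mulrC (le_trans l_lam)//.
apply: le_trans (expR_ge1Dx _).
have : 2 ^+ n.+1 <= gam ^+ n.+1 by exact: gam_ge.
have : 1 <= 2 ^+ n :> R by apply: exprn_ege1; lra.
rewrite exprS => h1 h2.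
have : l * 2 <= l * gam ^+ n.+1 by rewrite ler_wpM2l//; lra.
by lra.
Qed.

Lemma threshold_gap : 1 + 2 * lam / eta ^+ 2 <= b' - b.
Proof.
have lam0 := lam_gt0.
have eta2 : eta ^+ 2 = (1 + 4 * lam) ^+ 2 / b'.
  rewrite /eta exprMn -expRM_natr /b' -expRN; congr (_ * expR _).
  by field.
have -> : 2 * lam / eta ^+ 2 = (2 * lam / (1 + 4 * lam) ^+ 2) * b'.
  by rewrite eta2; field; rewrite !gt_eqF ?expR_gt0.
have : 2 * lam / (1 + 4 * lam) ^+ 2 <= 4^-1.
  by rewrite ler_pdivrMr ?exprn_gt0//; nra.
have b'0 : 0 < b' by exact: expR_gt0.
move=> h; have : (2 * lam / (1 + 4 * lam) ^+ 2) * b' <= 4^-1 * b'.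
  by rewrite ler_wpM2r// ltW.
by have := b_ge3; have := b'_ge; nra.
Qed.

(** The cube beats the factor (n + 1)^2 of [threshold_error]: the argument grows
    at least like 2^n, so that (n + 1)^2 / 8^n <= 4^n / 8^n. *)
Lemma expRN_cube_le (x : R) : 0 < x -> expR (- x) <= 6 / x ^+ 3.
Proof.
move=> x0; rewrite expRN -[6 / _]invrK lef_pV2 ?posrE ?expR_gt0//; last first.
  by rewrite invr_gt0 divr_gt0// exprn_gt0.
rewrite invf_div; apply: le_trans (expR_ge1Dxn 2 (ltW x0)).
by rewrite lerDr.
Qed.

Lemma threshold_error :
  2 * eta / lam * ((2 * n + 3)%:R * (n%:R * (lam * (2 * b))) + lam) <=
  72 * (1 + 4 * lam) / (l * (gam / 2 - 1)) ^+ 3 * 2^-1 ^+ n.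
Proof.
have l2 := l_ge2; have g2 := gam_gt2.
pose delta := gam / 2 - 1.
have d0 : 0 < delta by rewrite /delta; lra.
have l0 : 0 < l by lra.
have g0 : 0 < gam ^+ n by rewrite exprn_gt0//; lra.
have eb : eta * b = (1 + 4 * lam) * expR (- (l * delta * gam ^+ n)).
  rewrite /eta /b -mulrA -expRD; congr (_ * expR _).
  by rewrite /delta exprS; field.
have n2 : (n.+1%:R ^+ 2 : R) <= 4 ^+ n.
  have : (n.+1%:R : R) <= 2 ^+ n by rewrite -natrX ler_nat ltn_expl.
  rewrite (_ : 4 = 2 ^+ 2 :> R); last by ring.
  by rewrite exprAC => h; rewrite lerXn2r ?nnegrE.
have gn : 8 ^+ n <= (gam ^+ n) ^+ 3.
  rewrite (_ : 8 = 2 ^+ 3 :> R); last by ring.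
  by rewrite exprAC lerXn2r ?nnegrE ?exprn_ge0 ?gam_ge// ltW//; lra.
have cube := @expRN_cube_le (l * delta * gam ^+ n) _.
have {}cube : expR (- (l * delta * gam ^+ n)) <= 6 / (l * delta) ^+ 3 / 8 ^+ n.
  apply: le_trans (cube _) _; first by rewrite !mulr_gt0.
  rewrite [_ ^+ 3 in leLHS]exprMn invfM mulrA; apply: ler_wpM2l.
    by rewrite divr_ge0// exprn_ge0// mulr_ge0// ltW.
  by rewrite lef_pV2 ?posrE; [exact: gn|exact: exprn_gt0|exact: exprn_gt0].
have step1 : 2 * eta / lam * ((2 * n + 3)%:R * (n%:R * (lam * (2 * b))) + lam)
    <= 12 * n.+1%:R ^+ 2 * (eta * b).
  have -> : 2 * eta / lam * ((2 * n + 3)%:R * (n%:R * (lam * (2 * b))) + lam) =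
     2 * eta * ((2 * n + 3)%:R * n%:R * 2 * b + 1).
    by field; rewrite gt_eqF.
  have -> : 12 * n.+1%:R ^+ 2 * (eta * b) =
    2 * eta * (6 * n.+1%:R ^+ 2 * b) by ring.
  apply: ler_wpM2l; first by rewrite mulr_ge0// ltW// threshold_eta_gt0.
  rewrite natrD natrM -[n.+1]addn1 natrD.
  have := b_ge3; have : 0 <= n%:R :> R by [].
  move: n%:R => x x0 b3; nra.
apply: (le_trans step1); rewrite eb.
apply: (@le_trans _ _ (12 * 4 ^+ n *
    ((1 + 4 * lam) * (6 / (l * delta) ^+ 3 / 8 ^+ n)))).
  apply: ler_pM => //.
  - by rewrite mulr_ge0 ?expR_ge0 ?ltW.
  - by rewrite ler_wpM2l.
  - by rewrite ler_wpM2l// ltW.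
rewrite -/delta (_ : 8 ^+ n = 4 ^+ n * 2 ^+ n :> R); last first.
  by rewrite -exprMn; congr (_ ^+ _); ring.
rewrite exprVn le_eqVlt; apply/orP; left; apply/eqP.
have x0 : 4 ^+ n != 0 :> R by rewrite gt_eqF// exprn_gt0.
have y0 : 2 ^+ n != 0 :> R by rewrite gt_eqF// exprn_gt0.
have z0 : (l * delta) ^+ 3 != 0 by rewrite gt_eqF// exprn_gt0// mulr_gt0.
move: (4 ^+ n) (2 ^+ n) ((l * delta) ^+ 3) x0 y0 z0 => x y z x0 y0 z0.
by field; rewrite x0 y0 z0.
Qed.

End thresholds.

(** * The epochs of the greedy server *)

Section nat_valued.
Context (R : realType) d (Omega : measurableType d) (P : probability Omega R).

Lemma measurable_natr (g : Omega -> nat) :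
  (forall j, measurable (g @^-1` [set j])) ->
  measurable_fun setT (fun w => (g w)%:R : R).
Proof.
move=> mg _ B _; rewrite setTI.
rewrite (_ : _ @^-1` B = \bigcup_(j in [set j | B j%:R]) g @^-1` [set j]).
  by apply: bigcup_measurable.
by apply/seteqP; split => [w /= Bw|w [j /= Bj ->]//]; exists (g w).
Qed.

Lemma integral_natr (g : Omega -> nat) (A : set Omega) :
  measurable A -> (forall j, measurable (g @^-1` [set j])) ->
  (\int[P]_(w in A) ((g w)%:R : R)%:E =
   \sum_(0 <= j <oo) (j%:R%:E * P (A `&` g @^-1` [set j])))%E.
Proof.
move=> mA mg.
transitivity (\int[P]_(w in A)
    \sum_(0 <= j <oo) (j%:R%:E * (\1_(g @^-1` [set j]) w)%:E))%E.
  apply: eq_integral => w _; rewrite (@nneseriesD1 _ _ (g w)); last 2 first.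
  - by move=> j _; rewrite -EFinM lee_fin mulr_ge0.
  - by [].
  rewrite indicE mem_set// mule1 eseries0 ?adde0// => j _ /= jg.
  by rewrite indicE memNset ?mule0//=; apply/eqP; rewrite eq_sym.
transitivity (\sum_(0 <= j <oo)
    \int[P]_(w in A) (j%:R%:E * (\1_(g @^-1` [set j]) w)%:E))%E.
  apply: integral_nneseries => // j.
  apply: measurable_funeM; apply/measurable_EFinP.
  by apply: measurable_funTS; exact: measurable_indic.
apply: eq_eseriesr => j _; rewrite ge0_integralZl_EFin//; last first.
  by apply/measurable_EFinP; apply: measurable_funTS; exact: measurable_indic.
by rewrite integral_indic// setIC.
Qed.

End nat_valued.

Section greedy.
Context (R : realType) (lam : R).
Context (zeta : nat -> probability (measurableTypeR R) R).
Context d (Omega : measurableType d) (P : probability Omega R).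
Context (xi : nat -> Omega -> int) (Q : nat -> int -> Omega -> option nat)
  (X : nat -> Omega -> int) (tau T : nat -> Omega -> R).
Hypothesis lam_gt0 : 0 < lam.
Hypothesis Psi : greedy_server lam zeta P xi Q X tau T.

Let queue n k w : nat := odflt 0%N (Q n k w).

Let measurable_queue n k j : measurable (queue n k @^-1` [set j]).
Proof.
rewrite (_ : _ @^-1` _ = Q n k @^-1` [set Some j] `|`
   (if j == 0%N then Q n k @^-1` [set None] else set0)).
  by apply: measurableU; [|case: ifP => _ //]; exact: (gs_meas_Q Psi).
apply/seteqP; split => w; rewrite /queue /=.
  by case E: (Q n k w) => [m|] /= => [->|<-]; [left|right].
by case=> [->//|]; case: eqP => [-> /= ->//|].
Qed.

Let history_gen_measurable n : history_gen xi Q X T n `<=` measurable.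
Proof.
move=> A [[m _ [[[k _ [v _ <-]]|[v _ <-]]|[B mB <-]]]|[m _ [v _ <-]]].
- exact: (gs_meas_Q Psi).
- exact: (gs_meas_X Psi).
- by rewrite -[X in measurable X]setTI; exact: (gs_meas_T Psi).
- exact: (gs_meas_xi Psi).
Qed.

Let history_tie_measurable n : history_tie xi Q X T n `<=` measurable.
Proof.
apply: smallest_sub; [exact: sigma_algebra_measurable|].
move=> A [/history_gen_measurable//|[v _ <-]].
exact: (gs_meas_xi Psi).
Qed.

Let history_tie_tau_measurable n :
  history_tie_tau xi Q X tau T n `<=` measurable.
Proof.
apply: smallest_sub; [exact: sigma_algebra_measurable|].
move=> A [[/history_gen_measurable//|[v _ <-]]|[B mB <-]].
  exact: (gs_meas_xi Psi).
by rewrite -[X in measurable X]setTI; exact: (gs_meas_tau Psi).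
Qed.

(** Bounding all the times up to [n] makes these events decrease with [n] on
    every path, whereas the times themselves increase only almost surely. *)
Let below n b : set Omega := [set w | forall m, (m <= n)%N -> T m w <= b].

Let below_sigma n b (G : set (set Omega)) : history_gen xi Q X T n `<=` G ->
  <<s G>> (below n b).
Proof.
move=> GH; rewrite /below (_ : [set w | _] =
    \bigcap_(m in `I_n.+1) T m @^-1` `]-oo, b]%classic); last first.
  apply/seteqP; split => w /= h m mn; first by rewrite /= in_itv/=; exact: h.
  by have := h m mn; rewrite /= in_itv.
apply: (@bigcap_measurableType _ (g_sigma_algebraType G)) => m mn.
apply: sub_sigma_algebra; apply: GH; left; exists m => //.
by right; exists `]-oo, b]%classic => //; exact: measurable_itv.
Qed.

Let below_history_tie n b : history_tie xi Q X T n (below n b).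
Proof. by apply: below_sigma; exact: subsetUl. Qed.

Let measurable_below n b : measurable (below n b).
Proof. by apply: (@history_tie_measurable n); exact: below_history_tie. Qed.

Lemma ae_xi_sign : {ae P, forall w n, xi n w = 1 \/ xi n w = -1}.
Proof.
apply: ae_foralln => n.
have half v : v = 1 \/ v = -1 -> P (xi n @^-1` [set v]) = (2^-1)%:E.
  move=> /(gs_xi Psi n)[_ /(_ setT)]; rewrite setTI => ->.
    by rewrite integral_cst// [X in (_ * X)%E](_ : _ = 1%E) ?mule1//;
      exact: probability_setT.
  exact: (@measurableT _ (g_sigma_algebraType (history_gen xi Q X T n))).
have mxi v : measurable (xi n @^-1` [set v]) by exact: (gs_meas_xi Psi).
pose A := xi n @^-1` [set 1%Z] `|` xi n @^-1` [set (-1)%Z].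
have mA : measurable A by exact: measurableU.
have PA : P A = 1%E.
  transitivity (P (xi n @^-1` [set 1%Z]) + P (xi n @^-1` [set (-1)%Z]))%E.
    apply: measureU => //; apply/seteqP; split => w //= [-> //].
  rewrite !half; [|by right|by left].
  by rewrite -EFinD; congr EFin; lra.
exists (~` A); split; first exact: measurableC.
  by transitivity (1 - P A)%E; [exact: probability_setC|rewrite PA subee].
by move=> w /= h [h1|h1]; apply: h; [left|right].
Qed.

(** The queues that the server can visit at step [n.+1] are among 2 n + 3 fixed
    ones; this replaces the queue at the random position of the server by a sum
    over fixed positions. *)
Lemma ae_position_le : {ae P, forall w n, `|X n w| <= n%:Z}.
Proof.
apply: filterS ae_xi_sign => w xi1; elim => [|n IH].
  by rewrite (gs_X0 Psi).
rewrite (gs_XS Psi); set dir := direction _ _ _.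
have : `|dir| = 1.
  rewrite /dir /direction; case: ifP => // _; case: ifP => // _.
  by case: (xi1 n) => ->.
by lia.
Qed.

Let queueR n k w : \bar R := ((queue n k w)%:R)%:E.

Let measurable_queueR n k : measurable_fun setT (queueR n k).
Proof. by apply/measurable_EFinP; exact: measurable_natr. Qed.

(** When T_n and tau_(n+1) are at most [b], step n + 1 takes time at most [b]
    and ends at time at most [2 * b], so that, whether a queue is known already
    or newly inspected, its mean length increases by at most [lam * (2 * b)]. *)
Lemma queue_mean_le n k b : 0 <= b ->
  (\int[P]_(w in below n b) queueR n k w <= (n%:R * (lam * (2 * b)))%:E)%E.
Proof.
move=> b0; elim: n => [|n IH].
  rewrite integral0_eq ?mul0r// => w _.
  by rewrite /queueR /queue (gs_Q0 Psi); case: ifP.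
pose A := below n b `&` [set w | tau n.+1 w <= b].
have AG : history_tie_tau xi Q X tau T n A.
  apply: (@measurableI _ (g_sigma_algebraType
    (history_gen xi Q X T n `|` level_sets (xi n) `|`
       borel_preimages (tau n.+1)))).
    by apply: below_sigma => B HB; left; left.
  apply: sub_sigma_algebra; right; exists `]-oo, b]%classic.
    exact: measurable_itv.
  by apply/seteqP; split => w /=; rewrite in_itv.
have mA : measurable A by exact: (@history_tie_tau_measurable n _ AG).
have SA : below n.+1 b `<=` A.
  move=> w h; split=> [m mn|/=]; first by apply: h; rewrite ltnW.
  have := h n.+1 (leqnn _); rewrite (gs_TS Psi); apply: le_trans.
  by rewrite lerDr (gs_T_ge0 Psi).
pose f j w : R := entry_law lam (fun k' => Q n k' w) (X n.+1 w) (tau n.+1 w)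
   (T n.+1 w) k (Some j).
have f0 j w : 0 <= f j w.
  rewrite /f /entry_law; case: eqP => _ //; case: (Q n k w) => [m|].
    by case: ifP => // _; exact: poisson_mass_ge0.
  by case: ifP => // _; exact: poisson_mass_ge0.
have fP j : measurable_fun setT (fun w => (f j w)%:E) /\
    P (A `&` Q n.+1 k @^-1` [set Some j]) = (\int[P]_(w in A) (f j w)%:E)%E.
  have [] := @gs_QS _ _ _ _ _ _ _ _ _ _ _ Psi n [:: k] (fun=> Some j) isT.
  under eq_fun do rewrite big_seq1.
  rewrite (_ : [set w | _] = Q n.+1 k @^-1` [set Some j]); last first.
    apply/seteqP; split => w /= h; first by apply: h; rewrite inE.
    by move=> k'; rewrite inE => /eqP ->.
  move=> h1 h2; split; last exact: h2.
  move=> _ B mB; rewrite setTI; exact: (@history_tie_tau_measurable n _ (h1 B mB)).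
apply: (@le_trans _ _ (\int[P]_(w in A) queueR n.+1 k w)%E).
  apply: ge0_subset_integral => //.
    exact: measurable_funTS.
  by move=> w _; rewrite lee_fin.
rewrite [leLHS](_ : _ = \sum_(0 <= j <oo)
  (j%:R%:E * P (A `&` queue n.+1 k @^-1` [set j])))%E; last exact: integral_natr.
apply: (@le_trans _ _ (\int[P]_(w in A) \sum_(0 <= j <oo) (j%:R * f j w)%:E)%E).
  rewrite (_ : (\int[P]_(w in A) _ = \sum_(0 <= j <oo)
      \int[P]_(w in A) (j%:R * f j w)%:E)%E); last first.
    apply: integral_nneseries => // [j|j w _].
      apply: measurable_funTS; under eq_fun do rewrite EFinM.
      by apply: measurable_funeM; exact: (fP j).1.
    by rewrite lee_fin mulr_ge0.
  apply: lee_nneseries => [j _ _|j _]; first by rewrite mule_ge0// lee_fin.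
  under eq_integral do rewrite EFinM.
  rewrite ge0_integralZl_EFin//; last 2 first.
  - by move=> w _; rewrite lee_fin.
  - by apply: measurable_funTS; exact: (fP j).1.
  case: j => [|j]; first by rewrite !mul0e.
  rewrite -(fP j.+1).2 lee_wpmul2l ?lee_fin// le_measure// ?inE.
  - by apply: measurableI.
  - by apply: measurableI => //; exact: (gs_meas_Q Psi).
  - move=> w [Aw]; rewrite /queue /= => qw; split => //=.
    by case: (Q n.+1 k w) qw => //= m ->.
apply: (@le_trans _ _ (\int[P]_(w in A) (queueR n k w + (lam * (2 * b))%:E))%E).
  apply: ge0_le_integral => //.
  - by move=> w _; apply: nneseries_ge0 => j _ _; rewrite lee_fin mulr_ge0.
  - apply: ge0_emeasurable_sum => [j w _ _|j _]; first by rewrite lee_fin mulr_ge0.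
    apply: measurable_funTS; under eq_fun do rewrite EFinM.
    by apply: measurable_funeM; exact: (fP j).1.
  - by apply: emeasurable_funD => //; exact: measurable_funTS.
  - move=> w [Tb taub]; rewrite -EFinD; apply: entry_law_mean => //.
    + by rewrite mulr_ge0.
    + by apply: le_trans taub _; rewrite ler_peMl// ler1n.
    + rewrite (gs_TS Psi) mulr2n mulrDl mul1r; apply: lerD => //; exact: Tb.
have c0 : 0 <= lam * (2 * b) by rewrite !mulr_ge0// ltW.
rewrite ge0_integralD//; last 2 first.
- by move=> w _; rewrite lee_fin.
- exact: measurable_funTS.
rewrite [leRHS](_ : _ = (n%:R * (lam * (2 * b)))%:E + (lam * (2 * b))%:E)%E;
  last by rewrite -EFinD -[n.+1]addn1 natrD; congr EFin; ring.
apply: leeD.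
  apply: le_trans IH; apply: ge0_subset_integral => //.
  - exact: measurable_funTS.
  - by move=> w _; rewrite lee_fin.
  - by move=> w [].
rewrite integral_cst// -[leRHS]mule1 lee_wpmul2l//.
exact: probability_le1.
Qed.

(** Conditionally on the past the step time has a tail proportional to the
    length of the chosen queue plus [lam], which is then averaged. *)
Lemma step_time_tail n b eta t :
  0 <= b -> 0 < eta -> eta <= lam -> 1 + 2 * lam / eta ^+ 2 <= t ->
  (forall k, mm1_time_to_empty_law lam lam k (zeta k)) ->
  (P (below n b `&` tau n.+1 @^-1` `]t, +oo[%classic) <=
   ((2 * eta / lam) *
     ((2 * n + 3)%:R * (n%:R * (lam * (2 * b))) + lam))%:E)%E.
Proof.
move=> b0 eta0 eta_lam tE zetaP.
have c0 : 0 <= 2 * eta / lam by rewrite divr_ge0 ?mulr_ge0// ltW.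
have lam0 := ltW lam_gt0.
pose next w := odflt 0%N (Q n (X n.+1 w) w).
have [mp ->] := gs_tau Psi n (measurable_itv `]t, +oo[);
  last exact: below_history_tie.
have {}mp : measurable_fun setT
    (fun w => step_time_law lam zeta (next w) `]t, +oo[%classic).
  move=> _ B mB; rewrite setTI; exact: (@history_tie_measurable n _ (mp B mB)).
pose key (i : 'I_(2 * n + 3)) : int := i%:Z - n.+1%:Z.
have mq (i : 'I_(2 * n + 3)) : measurable_fun (below n b) (queueR n (key i)).
  exact: measurable_funTS.
apply: (@le_trans _ _ (\int[P]_(w in below n b)
    ((2 * eta / lam)%:E * (\sum_(i < 2 * n + 3) queueR n (key i) w + lam%:E)))%E).
  apply: ae_ge0_le_integral => //.
  - move=> w _; apply: nneseries_ge0 => j _ _.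
    by rewrite mule_ge0// lee_fin poisson_mass_ge0.
  - exact: measurable_funTS.
  - by move=> w _; rewrite mule_ge0 ?adde_ge0 ?sume_ge0// => i _; rewrite lee_fin.
  - apply: measurable_funeM; apply: emeasurable_funD => //.
    exact: emeasurable_sum.
  apply: filterS ae_position_le => w Xn _.
  apply: (le_trans (step_time_law_tail _ zetaP eta0 eta_lam tE)).
  have /= Xn1 := Xn n.+1.
  have ij : (absz (X n.+1 w + n.+1%:Z)%R < 2 * n + 3)%N by lia.
  have -> : odflt 0%N (Q n (X n.+1 w) w) = queue n (key (Ordinal ij)) w.
    by rewrite /queue (_ : key _ = X n.+1 w)// /key /=; lia.
  rewrite mulrC EFinM lee_wpmul2l// EFinD leeD2r// (bigD1 (Ordinal ij))//=.
  by rewrite leeDl// sume_ge0// => i _; rewrite lee_fin.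
rewrite ge0_integralZl_EFin//; last 2 first.
- by move=> w _; rewrite adde_ge0 ?sume_ge0// => i _; rewrite lee_fin.
- by apply: emeasurable_funD => //; exact: emeasurable_sum.
rewrite [leRHS]EFinM lee_wpmul2l// ge0_integralD//; last 2 first.
- by move=> w _; rewrite sume_ge0// => i _; rewrite lee_fin.
- exact: emeasurable_sum.
rewrite EFinD leeD//; last first.
  by rewrite integral_cst// -[leRHS]mule1 lee_wpmul2l//; exact: probability_le1.
rewrite ge0_integral_sum//; last by move=> i w _; rewrite lee_fin.
apply: (@le_trans _ _ (\sum_(i < 2 * n + 3) (n%:R * (lam * (2 * b)))%:E)%E).
  by apply: lee_sum => i _; exact: queue_mean_le.
by rewrite sumEFin lee_fin sumr_const card_ord -[leLHS]mulr_natl.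
Qed.

Let measurable_T_gt n b : measurable [set w | b < T n w].
Proof.
rewrite (_ : [set w | _] = T n @^-1` `]b, +oo[%classic).
  by rewrite -[X in measurable X]setTI; exact: (gs_meas_T Psi).
by apply/seteqP; split => w /=; rewrite in_itv/= andbT.
Qed.

Let measurable_escape (b : nat -> R) :
  measurable [set w | exists n, b n < T n w].
Proof.
rewrite (_ : [set w | _] = \bigcup_n [set w | b n < T n w]).
  exact: bigcup_measurable.
by apply/seteqP; split => w /= [n]; [exists n|move=> _; exists n].
Qed.

(** Sum [step_time_tail] over the step at which a threshold is first
    exceeded. *)
Lemma escape_probability gam l :
  (forall k, mm1_time_to_empty_law lam lam k (zeta k)) ->
  2 < gam -> 2 <= l -> (1 + 4 * lam) / lam <= l ->
  (P [set w | exists n, (expR (l * gam ^+ n) < T n w)%R] <=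
   (144 * (1 + 4 * lam) / (l * (gam / 2 - 1)) ^+ 3)%:E)%E.
Proof.
move=> zetaP gam2 l2 l_lam.
pose b n := expR (l * gam ^+ n).
pose F n := below n (b n) `&` tau n.+1 @^-1` `]b n.+1 - b n, +oo[%classic.
have mF n : measurable (F n).
  apply: measurableI => //; rewrite -[X in measurable X]setTI.
  exact: (gs_meas_tau Psi).
have b_nd i j : (i <= j)%N -> b i <= b j.
  move=> ij; rewrite ler_expR ler_wpM2l//; first lra.
  by apply: ler_weXn2l => //; lra.
have sub : [set w | exists n, b n < T n w] `<=` \bigcup_n F n.
  move=> w /= exn; case: (ex_minnP exn) => -[|n].
    by rewrite (gs_T0 Psi) => /(lt_trans (expR_gt0 _)); rewrite ltxx.
  move=> Tn n_min; exists n => //; split.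
    move=> m mn; apply: (@le_trans _ _ (b m)); last exact: b_nd.
    by rewrite leNgt; apply/negP => /n_min; lia.
  have Tnb : T n w <= b n by rewrite leNgt; apply/negP => /n_min; lia.
  rewrite /= in_itv/= andbT; move: Tn; rewrite (gs_TS Psi); lra.
apply: (le_trans (measure_sigma_subadditive P mF (measurable_escape b) sub)).
pose K := 72 * (1 + 4 * lam) / (l * (gam / 2 - 1)) ^+ 3.
apply: (@le_trans _ _ (\sum_(0 <= n <oo) (2 * K / (2 ^ (n + 1))%:R)%:E)%E).
  apply: lee_nneseries => n; first by move=> _ _; exact: measure_ge0.
  move=> _; apply: le_trans (step_time_tail n (expR_ge0 _)
    (threshold_eta_gt0 gam l n lam_gt0)
    (threshold_eta_le n lam_gt0 gam2 l2 l_lam)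
    (threshold_gap n lam_gt0 gam2 l2) zetaP) _.
  rewrite lee_fin; apply: le_trans (threshold_error n lam_gt0 gam2 l2) _.
  rewrite -/K addn1 expnS natrM natrX exprVn le_eqVlt; apply/orP; left; apply/eqP.
  have x0 : 2 ^+ n != 0 :> R by rewrite gt_eqF// exprn_gt0.
  by move: (2 ^+ n) x0 => x x0; field; rewrite x0.
rewrite (cvg_lim _ (@cvg_geometric_eseries_half R (2 * K) 0))// lee_fin expr0 divr1.
by rewrite /K le_eqVlt; apply/orP; left; apply/eqP; ring.
Qed.

(** The exceptional events for larger and larger [l] have probabilities tending
    to 0, and hence a null intersection. *)
Lemma ae_below_double_exponential gam :
  (forall k, mm1_time_to_empty_law lam lam k (zeta k)) -> 2 < gam ->
  {ae P, forall w, exists l, forall n, T n w <= expR (l * gam ^+ n)}.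
Proof.
move=> zetaP gam2.
pose l (j : nat) : R := 2 + (1 + 4 * lam) / lam + j%:R.
pose bad j := [set w | exists n, expR (l j * gam ^+ n) < T n w].
pose D := 144 * (1 + 4 * lam) / (gam / 2 - 1) ^+ 3.
have c0 : 0 < 1 + 4 * lam by rewrite addr_gt0// mulr_gt0.
have cl0 : 0 < (1 + 4 * lam) / lam by rewrite divr_gt0.
have d0 : 0 < gam / 2 - 1 by lra.
have D0 : 0 <= D by rewrite divr_ge0 ?mulr_ge0 ?exprn_ge0// ltW.
have mbad j : measurable (bad j) by exact: measurable_escape.
have Pbad j : (P (bad j) <= (D * j.+1%:R^-1)%:E)%E.
  have j0 : 0 <= j%:R :> R by [].
  apply: le_trans (escape_probability zetaP gam2 _ _) _; rewrite ?/l; [lra|lra|].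
  rewrite -/(l j) lee_fin exprMn invfM mulrA mulrAC -/D ler_wpM2l//.
  rewrite lef_pV2 ?posrE//; last first.
    by rewrite exprn_gt0// /l; lra.
  have l1 : j.+1%:R <= l j by rewrite /l -natr1; lra.
  apply: le_trans l1 _; rewrite exprS ler_peMr// ?exprn_ege1//; rewrite /l; lra.
have mN : measurable (\bigcap_j bad j) by exact: bigcapT_measurable.
exists (\bigcap_j bad j); split => //.
  apply/eqP; rewrite eq_le measure_ge0 andbT.
  rewrite -[leLHS]fineK ?fin_num_measure// lee_fin.
  have cD : (fun j => D * harmonic j) @ \oo --> D * 0.
    by apply: cvgM; [exact: cvg_cst|exact: cvg_harmonic].
  rewrite mulr0 in cD.
  apply: (ler_cvg_to (cvg_cst _) cD); apply: nearW => j.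
  rewrite -lee_fin fineK ?fin_num_measure//; apply: le_trans (Pbad j).
  by apply: le_measure; rewrite ?inE//; exact: bigcap_inf.
move=> w /= h j _; apply: contrapT => nb; apply: h; exists (l j) => n.
by rewrite leNgt; apply/negP => Tn; apply: nb; exists n.
Qed.

End greedy.

Unset Implicit Arguments.
Set Strict Implicit.

Theorem proposition4p2 (R : realType) (lam : R) (lam_gt0 : 0 < lam)
  (zeta : nat -> probability (measurableTypeR R) R)
  (zetaP : forall k : nat, mm1_time_to_empty_law lam lam k (zeta k))
  (d : measure_display) (Omega : measurableType d) (P : probability Omega R)
  (xi : nat -> Omega -> int) (Q : nat -> int -> Omega -> option nat)
  (X : nat -> Omega -> int) (tau T : nat -> Omega -> R)
  (Psi : greedy_server lam zeta P xi Q X tau T)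
  (beta : R) (beta_gt2 : 2 < beta) :
  {ae P, forall w : Omega, \forall n \near \oo,
     tau n w <= T n w /\ T n w <= expR (beta ^+ n)}.
Proof.
pose gam := 1 + beta / 2.
have gam2 : 2 < gam by rewrite /gam; lra.
apply: filterS (ae_below_double_exponential lam_gt0 Psi zetaP gam2) => w [l Tl].
have cvg0 : (fun n => `|l| * (gam / beta) ^+ n) @ \oo --> (0 : R).
  have gb0 : 0 <= gam / beta by apply: divr_ge0; lra.
  by apply: cvg_geometric; rewrite ger0_norm// ltr_pdivrMr /gam; lra.
have near1 : \forall n \near \oo, `|l| * (gam / beta) ^+ n < 1.
  by apply: (cvgr_lt _ cvg0); exact: ltr01.
near=> n.
have n0 : (0 < n)%N by near: n; exact: nbhs_infty_gt.
split.
  by rewrite -(prednK n0) (gs_TS Psi) lerDr (gs_T_ge0 Psi).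
apply: le_trans (Tl n) _; rewrite ler_expR.
have bn : 0 < beta ^+ n by rewrite exprn_gt0//; lra.
have : `|l| * (gam / beta) ^+ n < 1 by near: n.
rewrite expr_div_n mulrA ltr_pdivrMr// mul1r => /ltW; apply: le_trans.
by rewrite ler_wpM2r ?ler_norm// exprn_ge0//; lra.
Unshelve. all: by end_near. Qed.
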